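(* There exist absolute constants $C,\bar C>0$ such that the following holds. Let $d_1\le d_2\le d_3$ be positive integers. Let $\lambda,\mu,\nu$ be partitions of $n$ of levels $d_1,d_2$ and $d_3$ respectively. Then $$g(\lambda,\mu,\nu)\le\left(\frac{C^{d_3}d_1^{d_1}d_2^{d_2}d_3^{d_3}}{n^{d_1+d_2+d_3}}\chi_\lambda(1)\chi_\mu(1)\chi_\nu(1)\right)^{1/3}\le\bar C^{d_3}d_1^{d_1/6}d_2^{d_2/6}d_3^{d_3/6}.$$
   Context: For a partition $\lambda=(\lambda_1\ge\lambda_2\ge\cdots)$ of $n$, $\chi_\lambda$ is the corresponding irreducible complex character of the symmetric group $S_n$. Write $\lambda'$ for the conjugate partition, so $\lambda_1'$ is the number of parts of $\lambda$. The level of $\lambda$ (equivalently of $\chi_\lambda$) is $\min(n-\lambda_1,\,n-\lambda_1')$. The Kronecker coefficient is $g(\lambda,\mu,\nu)=\frac{1}{n!}\sum_{\sigma\in S_n}\chi_\lambda(\sigma)\chi_\mu(\sigma)\chi_\nu(\sigma)$, i.e. the multiplicity of the Specht module $V_\nu$ in $V_\lambda\otimes V_\mu$. *)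

(* Defs.v *)
From mathcomp Require Import all_boot all_order all_fingroup all_algebra all_field all_character.

Set Implicit Arguments.
Unset Strict Implicit.
Unset Printing Implicit Defensive.

Import Order.TTheory GRing.Theory Num.Theory.
Local Open Scope ring_scope.

(* Partitions are lists of nonzero parts. *)
Definition is_partition_of (n : nat) (la : seq nat) : bool :=
  [&& sorted geq la, 0%N \notin la & sumn la == n].

Definition conj_partition (la : seq nat) : seq nat :=
  [seq count (ltn j) la | j <- iota 0 (head 0%N la)].

Definition level (la : seq nat) : nat :=
  minn (sumn la - head 0%N la) (sumn la - head 0%N (conj_partition la)).

(* The tableau of shape la is the one with entries 0, ..., n.-1 in reading
   order: i lies in row reshape_index la i and column reshape_offset la i. *)
Definition row_stab (n : nat) (la : seq nat) : {set 'S_n} :=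
  [set s : 'S_n |
     [forall i : 'I_n, reshape_index la (s i) == reshape_index la i]].

Definition col_stab (n : nat) (la : seq nat) : {set 'S_n} :=
  [set s : 'S_n |
     [forall i : 'I_n, reshape_offset la (s i) == reshape_offset la i]].

(* The Young symmetrizer a_la * b_la, where a_la is the sum of row_stab and
   b_la the signed sum of col_stab, as a coefficient vector in C[S_n].
   MathComp composes permutations from left to right, so that the usual
   composite p o q is written q * p, and the usual left ideal
   C[S_n] * (a_la * b_la) is a right submodule of the regular representation. *)
Definition young_symmetrizer (n : nat) (la : seq nat) :
    'rV[algC]_#|[set: 'S_n]| :=
  gring_row (\sum_(p in row_stab n la) \sum_(q in col_stab n la)
    (-1) ^+ q *: regular_repr algC [set: 'S_n] (q * p)%g).

Definition specht_repr (n : nat) (la : seq nat) :=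
  submod_repr (cyclic_mx_module (regular_repr algC [set: 'S_n])
                                (young_symmetrizer n la)).

Definition chi (n : nat) (la : seq nat) : 'CF([set: 'S_n]) :=
  cfRepr (specht_repr n la).

Definition kronecker (n : nat) (la mu nu : seq nat) : algC :=
  n`!%:R^-1 * \sum_(s : 'S_n) chi n la s * chi n mu s * chi n nu s.

(* Main.v *)
Require Import Defs.
From mathcomp Require Import all_boot all_order all_fingroup all_algebra all_field all_character.
From mathcomp Require Import zify ring.

(** Let chi be the character of a partition of n of level d, and let C be the
    first row of its tableau, or the first column if the latter is longer, so that
    #|C| = n - d.  In the right ideal b a C[S_n] generated by the Young
    symmetrizer, let U be the span of the translates of the symmetrizer by the
    permutations that fix C pointwise, and let u be its dimension.  On U the group
    Sym C acts by the trivial or by the sign character, and the translates of U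
    span the ideal and are indexed by the images of C.  This structure alone
    (predicate [localized]) yields three bounds.

    - Counting translates gives chi(1) <= binomial(n, d) u.
    - Frobenius reciprocity gives u chi(1) <= n! / (n - d)!.  Together these imply
      chi(1)^2 <= n^(2 d) / d! ([localized_degree_sqr]).
    - For irreducible characters chi_1, chi_2, chi_3 with Kronecker coefficient g,
      the conjugate of chi_3 occurs g times in chi_1 chi_2; hence g u_3 is at most
      the number of vectors of type +1 or sign under Sym C_3 in the tensor product
      of the first two.  That space is spanned by the projections of pairs of
      translates of U_1 and U_2, and up to the action of Sym C_3 the complements of
      the two corresponding images of C_1 and C_2 lie in a fixed set of
      d_1 + d_2 + d_3 points; so g u_3 <= 4^(d_1 + d_2 + d_3) u_1 u_2
      ([kron_bound]).

    The product of the three bounds obtained by permuting the characters is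
    g^3 <= 64^(d_1 + d_2 + d_3) u_1 u_2 u_3, and the first inequality follows from
    a bound on u in terms of the degree, n^d u <= 2^d d^d chi(1)
    ([local_rank_bound]).  For the latter, let t <= n / 2 be the number of points of
    C with another entry in their column (or row).  For the sets X of d points that
    avoid them, choose a permutation that fixes them and sends the complement of C
    to X.  The translates of U by these permutations are in direct sum
    ([young_degree_ge]), because an element of U is determined by its values on
    the permutations fixing C pointwise, where the other translates vanish.  Hence
    chi(1) >= binomial(n - t, d) u.

    The second inequality follows from the bound on chi(1)^2.  Irreducibility of
    the ideal, used for the multiplicities, comes from the classical fact that
    b x a is a multiple of b a for all x ([young_sandwich]). *)

Set Implicit Arguments.
Unset Strict Implicit.
Unset Printing Implicit Defensive.

Import Order.TTheory GRing.Theory Num.Theory.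
Local Open Scope ring_scope.

(** * Twisted means over subgroups *)

(** If L = C R is a full-rank factorization, then L^2 = k L forces R C = k, and
    the trace of C R is that of R C.  For k = 1 this computes the rank of a
    projection by its trace, for k = 0 it says that square-zero matrices have
    trace zero. *)
Lemma mxtrace_quasi_idempotent (F : fieldType) n (L : 'M[F]_n) k :
  L *m L = k *: L -> \tr L = k * (\rank L)%:R.
Proof.
move=> LL; have := (mulmx_base L, col_base_full L, row_base_free L).
move: (col_base L) (row_base L) => C R [[defL /row_fullP[B BC] freeR]].
have E: C *m (R *m C *m R) = C *m (k%:M *m R).
  by rewrite mul_scalar_mx -scalemxAr defL -LL -[in RHS]defL !mulmxA.
suff RC: R *m C = k%:M by rewrite -[in LHS]defL mxtrace_mulC RC mxtrace_scalar mulr_natr.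
apply: (row_free_inj freeR).
by move/(congr1 (mulmx B)): E; rewrite !(mulmxA B) BC !mul1mx => /= ->.
Qed.

Section Sign.
Variable T : finType.
Implicit Types (s : bool) (g h : {perm T}).

(** The trivial character and the sign are treated at once, because the first
    row and the first column of a diagram play symmetric roles up to sign. *)
Definition twist s g : algC := (-1) ^+ (s && odd_perm g).

Lemma twistM s : {morph twist s : g h / (g * h)%g >-> g * h}.
Proof.
by move=> g h; rewrite /twist odd_permM; case: s; rewrite ?mulr1 //= signr_addb.
Qed.

Lemma twist1 s : twist s 1%g = 1.
Proof. by rewrite /twist odd_perm1 andbF. Qed.

Lemma twist_sqr s g : twist s g * twist s g = 1.
Proof. by rewrite /twist -expr2 sqrr_sign. Qed.

Lemma twistV s g : twist s g^-1%g = twist s g.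
Proof. by rewrite /twist odd_permV. Qed.

Lemma conj_twist s g : (twist s g)^* = twist s g.
Proof. by rewrite rmorph_sign. Qed.

End Sign.

Section TwistedAverage.
Variables (T : finType) (H : {group {perm T}}) (s : bool).
Local Notation G := [set: {perm T}].

(** The multiplicity in phi, restricted to H, of the linear character twist s. *)
Definition twisted_mean (phi : {perm T} -> algC) : algC :=
  #|H|%:R^-1 * \sum_(h in H) twist s h * phi h.

Definition twisted_proj n (rG : mx_representation algC G n) : 'M[algC]_n :=
  #|H|%:R^-1 *: \sum_(h in H) twist s h *: rG h.

Let cardH_neq0 : #|H|%:R != 0 :> algC.
Proof. by rewrite pnatr_eq0 -lt0n cardG_gt0. Qed.

Section Repr.
Variables (n : nat) (rG : mx_representation algC G n).
Local Notation E := (twisted_proj rG).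

Lemma twisted_proj_absorb h : h \in H -> rG h *m E = twist s h *: E.
Proof.
move=> Hh; rewrite /twisted_proj -scalemxAr scalerA mulrC -scalerA; congr (_ *: _).
rewrite mulmx_sumr scaler_sumr [RHS](reindex_inj (mulgI h)) /=.
apply: eq_big => [x|x Hx]; first by rewrite groupMl.
by rewrite -scalemxAr repr_mxM ?inE // twistM scalerA mulrA twist_sqr mul1r.
Qed.

Lemma twisted_proj_absorb_r h : h \in H -> E *m rG h = twist s h *: E.
Proof.
move=> Hh; rewrite /twisted_proj -scalemxAl scalerA mulrC -scalerA; congr (_ *: _).
rewrite mulmx_suml scaler_sumr [RHS](reindex_inj (mulIg h)) /=.
apply: eq_big => [x|x Hx]; first by rewrite groupMr.
by rewrite -scalemxAl repr_mxM ?inE // twistM scalerA mulrCA twist_sqr mulr1.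
Qed.

Lemma twisted_proj_envelop : (E \in enveloping_algebra_mx rG)%MS.
Proof.
rewrite /twisted_proj linearZ scalemx_sub // linear_sum summx_sub // => h _.
by rewrite linearZ scalemx_sub // envelop_mx_id ?inE.
Qed.

Lemma twisted_proj_id m (U : 'M_(m, n)) :
  (forall h, h \in H -> U *m rG h = twist s h *: U) -> U *m E = U.
Proof.
move=> Uh; rewrite /twisted_proj -scalemxAr mulmx_sumr.
rewrite (eq_bigr (fun=> U)) => [|h Hh]; last first.
  by rewrite -scalemxAr Uh // scalerA twist_sqr scale1r.
by rewrite sumr_const -scaler_nat scalerA mulVf // scale1r.
Qed.

Lemma twisted_proj_idem : E *m E = E.
Proof.
rewrite {1}/twisted_proj -scalemxAl mulmx_suml.
rewrite (eq_bigr (fun=> E)) => [|h Hh]; last first.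
  by rewrite -scalemxAl twisted_proj_absorb // scalerA twist_sqr scale1r.
by rewrite sumr_const -scaler_nat scalerA mulVf // scale1r.
Qed.

Lemma twisted_mean_repr : twisted_mean (cfRepr rG) = (\rank E)%:R.
Proof.
have := @mxtrace_quasi_idempotent _ _ E 1; rewrite scale1r mul1r => <-; last first.
  exact: twisted_proj_idem.
rewrite /twisted_proj mxtraceZ /twisted_mean; congr (_ * _).
rewrite [RHS](raddf_sum (@mxtrace algC n)); apply: eq_bigr => h Hh.
by rewrite cfunE inE mulr1n /= mxtraceZ.
Qed.

Lemma twisted_mean_ge_rank m (U : 'M_(m, n)) :
  (forall h, h \in H -> U *m rG h = twist s h *: U) ->
  (\rank U)%:R <= twisted_mean (cfRepr rG).
Proof.
by move/twisted_proj_id=> UE; rewrite twisted_mean_repr ler_nat -UE mxrankM_maxr.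
Qed.

End Repr.

Lemma twisted_mean_conj (phi : 'CF(G)) :
  twisted_mean (phi^*)%CF = (twisted_mean phi)^*.
Proof.
rewrite /twisted_mean rmorphM fmorphV rmorph_nat rmorph_sum; congr (_ * _).
by apply: eq_bigr => h _; rewrite cfunE rmorphM /= conj_twist.
Qed.

Lemma twisted_mean_char_nat (phi : 'CF(G)) :
  phi \is a character -> twisted_mean phi \is a Num.nat.
Proof.
by case/char_reprP=> -[n rG] -> /=; rewrite twisted_mean_repr natr_nat.
Qed.

(** The mean is linear in phi, and a natural number on each irreducible
    constituent, so the constituents other than theta only increase it. *)
Lemma twisted_mean_constt (phi theta : 'CF(G)) :
  phi \is a character -> theta \in irr G ->
  '[phi, theta] * twisted_mean theta <= twisted_mean phi.
Proof.
move=> Nphi /irrP[i ->{theta}].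
have lin : twisted_mean phi = \sum_j '[phi, 'chi_j] * twisted_mean 'chi_j.
  rewrite {1}[phi]cfun_sum_cfdot /twisted_mean.
  under eq_bigr => h _ do rewrite sum_cfunE mulr_sumr.
  rewrite exchange_big mulr_sumr; apply: eq_bigr => j _.
  rewrite [RHS]mulrCA [in RHS]mulr_sumr; congr (_ * _); apply: eq_bigr => h _.
  by rewrite cfunE mulrCA.
rewrite lin (bigD1 i) //= lerDl; apply: sumr_ge0 => j _.
rewrite mulr_ge0 // natr_ge0 //.
  by rewrite Cnat_cfdot_char_irr.
exact/twisted_mean_char_nat/irr_char.
Qed.

(** The regular character contains theta with multiplicity its degree, and its
    mean over H is the index of H. *)
Lemma twisted_mean_irr_deg (theta : 'CF(G)) : theta \in irr G ->
  theta 1%g * twisted_mean theta <= #|G|%:R / #|H|%:R.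
Proof.
move=> Itheta; have := twisted_mean_constt (cfReg_char [group of G]) Itheta.
have -> : '[cfReg G, theta] = theta 1%g.
  case/irrP: Itheta => i ->; rewrite cfReg_sum cfdot_suml (bigD1 i) //=.
  rewrite cfdotZl cfnorm_irr mulr1 big1 ?addr0 // => j ne_ji.
  by rewrite cfdotZl cfdot_irr (negPf ne_ji) mulr0.
move/le_trans; apply; rewrite /twisted_mean (bigD1 1%g) //=.
rewrite big1 => [|h /andP[_ /negPf h1]]; last by rewrite cfRegE h1 mulr0.
by rewrite addr0 twist1 mul1r cfRegE eqxx mulrC.
Qed.

End TwistedAverage.

(** * Moving subsets by permutations *)

Section MovingSets.
Variable T : finType.
Implicit Types (X Y Z : {set T}) (g h : {perm T}).

Lemma imset_permM g h X : (g * h)%g @: X = h @: (g @: X).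
Proof. by rewrite -imset_comp; apply: eq_imset => x; rewrite /= permM. Qed.

Lemma imset_perm1 X : (1%g : {perm T}) @: X = X.
Proof. by apply: im_perm_on; exact: perm_on1. Qed.

Lemma imset_permC g X : g @: (~: X) = ~: (g @: X).
Proof.
apply/setP=> x; rewrite -[x](permKV g) mem_imset ?inE; last exact: perm_inj.
by rewrite mem_imset //; exact: perm_inj.
Qed.

(** A point of X outside Y can be exchanged by a transposition with a point of Y
    outside X; this lowers the cardinal of X minus Y. *)
Lemma perm_moving_into Z X Y : X \subset Z -> Y \subset Z -> (#|X| <= #|Y|)%N ->
  exists2 h, perm_on Z h & h @: X \subset Y.
Proof.
move=> + sYZ; have [k] := ubnP #|X :\: Y|; elim: k X => // k IHk X.
rewrite ltnS => leXk sXZ leXY; have [sXY|] := boolP (X \subset Y).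
  by exists 1%g; rewrite ?perm_on1 // imset_perm1.
case/subsetPn=> x Xx Y'x.
have [sYX|] := boolP (Y \subset X).
  have /eqP defY: Y == X by rewrite eqEcard sYX.
  by rewrite defY Xx in Y'x.
case/subsetPn=> y Yy X'y; pose t := tperm x y.
have tZ : perm_on Z t.
  apply/subsetP=> z; rewrite inE; case: tpermP => [->|->|]; rewrite ?eqxx // => _.
    exact: (subsetP sXZ).
  exact: (subsetP sYZ).
have tX' : t @: X :\: Y \subset (X :\: Y) :\ x.
  apply/subsetP=> z; rewrite !inE => /andP[Y'z /imsetP[u Xu def_z]].
  move: def_z Y'z; rewrite /t permE /=; case: (u =P x) => [_ -> | /eqP ux].
    by rewrite Yy.
  case: (u =P y) => [def_u | _ -> ->]; last by rewrite ux Xu.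
  by rewrite def_u (negPf X'y) in Xu.
have [||| h hZ shX] := IHk (t @: X).
- apply: leq_trans leXk; rewrite (cardsD1 x (X :\: Y)) !inE Xx Y'x.
  exact: subset_leq_card.
- by rewrite -(im_perm_on tZ) imsetS.
- by rewrite card_imset //; exact: perm_inj.
by exists (t * h)%g; [exact: perm_onM | rewrite imset_permM].
Qed.

Lemma perm_moving_onto Z X Y : X \subset Z -> Y \subset Z -> #|X| = #|Y| ->
  exists2 h, perm_on Z h & h @: X = Y.
Proof.
move=> sXZ sYZ eqXY; have [h hZ shX] := perm_moving_into sXZ sYZ (eq_leq eqXY).
exists h => //; apply/eqP; by rewrite eqEcard shX (card_imset _ (@perm_inj _ h)) eqXY /=.
Qed.

(** The setwise stabilizer of X is the product of the two symmetric groups on X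
    and on its complement. *)
Lemma perm_stabilizer_split X g : g @: X = X ->
  exists h k, [/\ perm_on X h, perm_on (~: X) k & g = (h * k)%g].
Proof.
move=> gX; have nXg : g \in ('N(X | 'P))%g.
  apply/astabsP => x /=; rewrite apermE -{1}gX mem_imset //; exact: perm_inj.
pose h := restr_perm X g; have hX : perm_on X h by exact: restr_perm_on.
exists h, (h^-1 * g)%g; split=> //; last by rewrite mulKVg.
apply/subsetP=> x; rewrite !inE; apply: contra => Xx.
have Xhx: h^-1%g x \in X by rewrite (perm_closed _ (perm_onV hX)).
by rewrite permM -(restr_permE nXg Xhx) -/h permKV.
Qed.

End MovingSets.

(** * Localized representations *)

Section TensorSpan.
Variable F : fieldType.

Lemma tprodDl m1 n1 (A B : 'M[F]_(m1, n1)) m2 n2 (M : 'M[F]_(m2, n2)) :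
  tprod (A + B) M = tprod A M + tprod B M.
Proof.
elim: m1 A B => [|m1 IHm] A B /=; first by rewrite addr0.
by rewrite add_col_mx !linearD /= IHm -!trowbE linearD.
Qed.

Lemma tprodDr m1 n1 (A : 'M[F]_(m1, n1)) m2 n2 (M N : 'M[F]_(m2, n2)) :
  tprod A (M + N) = tprod A M + tprod A N.
Proof.
elim: m1 A => [|m1 IHm] A /=; first by rewrite addr0.
by rewrite add_col_mx IHm linearD.
Qed.

Lemma tprod0l m1 n1 m2 n2 (M : 'M[F]_(m2, n2)) : tprod (0 : 'M[F]_(m1, n1)) M = 0.
Proof. by apply: (addrI (tprod 0 M)); rewrite -tprodDl !addr0. Qed.

Lemma tprod0r m1 n1 (A : 'M[F]_(m1, n1)) m2 n2 : tprod A (0 : 'M[F]_(m2, n2)) = 0.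
Proof. by apply: (addrI (tprod A 0)); rewrite -tprodDr !addr0. Qed.

Lemma tprod_sub m1 m1' n1 (A : 'M[F]_(m1, n1)) (A' : 'M_(m1', n1))
                m2 m2' n2 (M : 'M[F]_(m2, n2)) (M' : 'M_(m2', n2)) :
  (A <= A')%MS -> (M <= M')%MS -> (tprod A M <= tprod A' M')%MS.
Proof.
by move=> /submxP[u ->] /submxP[v ->]; rewrite tprodE submxMl.
Qed.

(** If the A i span one space and the M j span another one, then their pairwise
    tensor products span the tensor product. *)
Lemma tprod_sums_sub (I J : finType) n1 n2 (A : I -> 'M[F]_n1) (M : J -> 'M[F]_n2) :
  (1%:M <= \sum_i A i)%MS -> (1%:M <= \sum_j M j)%MS ->
  (1%:M <= \sum_i \sum_j <<tprod (A i) (M j)>>)%MS.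
Proof.
move=> /sub_sumsmxP[u def1] /sub_sumsmxP[v def1'].
rewrite -tprod1 def1 def1' 
  (big_morph (fun B => tprod B _) (fun B B' => tprodDl B B' _) (tprod0l _ _ _)).
apply: summx_sub => i _; rewrite 
  (big_morph (fun B => tprod _ B) (fun B B' => tprodDr _ B B') (tprod0r _ _ _)).
apply: summx_sub => j _; apply: (sumsmx_sup i) => //; apply: (sumsmx_sup j) => //.
by rewrite genmxE tprod_sub ?submxMl.
Qed.

End TensorSpan.

Section Localized.
Variable T : finType.
Local Notation G := [set: {perm T}].

(** U spans a subspace on which the permutations of C act by a linear character,
    which is stable under those of the complement of C, and whose translates
    span the representation.  The translates of U are then indexed by the images
    of C, so the representation is a quotient of one induced from the stabilizer
    of C.  For the representation attached to a partition with first row n - d,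
    C has n - d points and everything happens on the d remaining ones. *)
Definition localized n (rG : mx_representation algC G n) (s : bool)
    (C : {set T}) k (U : 'M[algC]_(k, n)) : Prop :=
  [/\ forall h, perm_on C h -> U *m rG h = twist s h *: U,
      forall h, perm_on (~: C) h -> (U *m rG h <= U)%MS
    & (1%:M <= \sum_g <<U *m rG g>>)%MS].

(** A choice of a permutation that sends C to X; meaningful when #|X| = #|C|. *)
Definition carrier_perm (C X : {set T}) : {perm T} :=
  odflt 1%g [pick g : {perm T} | g @: C == X].

Lemma carrier_permE (C : {set T}) (g : {perm T}) : carrier_perm C (g @: C) @: C = g @: C.
Proof. by rewrite /carrier_perm; case: pickP => [h /eqP // | /(_ g)/eqP]. Qed.

Section OneRepr.
Variables (n : nat) (rG : mx_representation algC G n) (s : bool) (C : {set T}).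
Variables (k : nat) (U : 'M[algC]_(k, n)).
Hypothesis locU : localized rG s C U.

Definition localized_at X := U *m rG (carrier_perm C X).

(** Two permutations with the same effect on the set C differ by an element of
    its stabilizer, which preserves U. *)
Lemma localized_translate_sub g : (U *m rG g <= localized_at (g @: C))%MS.
Proof.
have [Ufix Ustab _] := locU; rewrite /localized_at; set g' := carrier_perm _ _.
have := @perm_stabilizer_split _ C (g * g'^-1)%g.
case=> [|h [l [hC lC' def_g]]].
  by rewrite imset_permM -(carrier_permE C g) -/g' -imset_permM mulgV imset_perm1.
have ->: g = (h * l * g')%g by rewrite -def_g mulgKV.
rewrite !repr_mxM ?inE // !mulmxA (Ufix h) // -!scalemxAl.
by rewrite scalemx_sub // submxMr ?Ustab.
Qed.

(** The translates of U span, and there is one of them for each set of size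
    #|C|. *)
Lemma localized_degree_le : (n <= 'C(#|T|, #|C|) * k)%N.
Proof.
have [_ _ full] := locU; rewrite -[n in (n <= _)%N](mxrank1 algC n).
have /mxrankS := full; move/leq_trans; apply.
have sub : (\sum_g <<U *m rG g>> <=
            \sum_(X in [set X : {set T} | #|X| == #|C|]) <<localized_at X>>)%MS.
  apply/sumsmx_subP=> g _; rewrite genmxE; apply: (sumsmx_sup (g @: C)).
    by rewrite inE card_imset //; exact: perm_inj.
  by rewrite genmxE localized_translate_sub.
apply: leq_trans (mxrankS sub) _.
apply: leq_trans (mxrank_sum_leqif _) _ => /=.
rewrite -card_draws -sum_nat_const; apply: leq_sum => X _.
by rewrite genmxE rank_leq_row.
Qed.

End OneRepr.

(** The tensor product is spanned by the products of a translate of U1 and one of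
    U2, hence by blocks indexed by pairs of sets X1, X2 of the sizes of C1, C2.
    The projection onto the twisted invariants of Sym C has, up to sign, the same
    image on two blocks exchanged by an element of Sym C.  Such an element moves
    the complements of X1 and X2 into E as soon as E is large enough, so that
    pairs of subsets of E are enough to index the blocks. *)
Lemma localized_tensor_rank n1 (rG1 : mx_representation algC G n1) s1 (C1 : {set T})
    k1 (U1 : 'M_(k1, n1)) n2 (rG2 : mx_representation algC G n2) s2 (C2 : {set T})
    k2 (U2 : 'M_(k2, n2)) s (C E : {set T}) :
  localized rG1 s1 C1 U1 -> localized rG2 s2 C2 U2 ->
  ~: C \subset E -> (#|~: C1| + #|~: C2| <= #|E :&: C|)%N || (E == [set: T]) ->
  (\rank (twisted_proj (Sym_group C) s (prod_repr rG1 rG2))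
     <= 2 ^ #|E| * 2 ^ #|E| * (k1 * k2))%N.
Proof.
move=> loc1 loc2 sC'E bigE; set P := twisted_proj _ _ _.
pose V D D' := tprod (localized_at rG1 C1 U1 (~: D)) (localized_at rG2 C2 U2 (~: D')) *m P.
have sub : (P <= \sum_(D in powerset E) \sum_(D' in powerset E) <<V D D'>>)%MS.
  have [_ _ full1] := loc1; have [_ _ full2] := loc2.
  have := submxMr P (tprod_sums_sub full1 full2); rewrite mul1mx.
  move/submx_trans; apply; rewrite sumsmxMr; apply/sumsmx_subP=> g1 _.
  rewrite sumsmxMr; apply/sumsmx_subP=> g2 _.
  have step : (<<tprod <<U1 *m rG1 g1>> <<U2 *m rG2 g2>>>> *m P
                 <= tprod (U1 *m rG1 g1) (U2 *m rG2 g2) *m P)%MS.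
    by rewrite submxMr // genmxE tprod_sub ?genmxE.
  apply: submx_trans step _.
  (* Only the part of the two complements inside C can be moved. *)
  pose X := (~: (g1 @: C1) :|: ~: (g2 @: C2)) :&: C.
  have [h hC hX] : exists2 h, perm_on C h & h @: X \subset E :&: C.
    case/orP: bigE => [leE | /eqP->]; last first.
      exists 1%g; first exact: perm_on1.
      by rewrite imset_perm1 setTI subsetIr.
    apply: perm_moving_into; rewrite ?subsetIr //; apply: leq_trans leE.
    apply: leq_trans (subset_leq_card (subsetIl _ _)) _.
    apply: leq_trans (leq_card_setU _ _) _.
    by rewrite -!imset_permC !card_imset //; exact: perm_inj.
  have sub_E (g : {perm T}) (Y : {set T}) :
      ~: (g @: Y) :&: C \subset X -> ~: ((g * h)%g @: Y) \in powerset E.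
    move=> sgY; rewrite inE imset_permM -imset_permC; apply/subsetP=> _ /imsetP[y gy ->].
    have [Cy | C'y] := boolP (y \in C).
      have: h y \in E :&: C.
        by apply: (subsetP hX); rewrite imset_f // (subsetP sgY) // in_setI gy.
      by case/setIP.
    by rewrite (out_perm hC) // (subsetP sC'E) // inE.
  have -> : tprod (U1 *m rG1 g1) (U2 *m rG2 g2) *m P =
      twist s h *: (tprod (U1 *m rG1 (g1 * h)%g) (U2 *m rG2 (g2 * h)%g) *m P).
    have Hh : h \in Sym_group C by rewrite inE.
    rewrite !repr_mxM ?inE // !mulmxA (tprodE _ (rG1 h) _ (rG2 h)) -mulmxA.
    have -> : tprod (rG1 h) (rG2 h) *m P = twist s h *: P.
      exact: (twisted_proj_absorb s (prod_repr rG1 rG2) Hh).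
    by rewrite -[in RHS]scalemxAr scalerA twist_sqr scale1r.
  apply: scalemx_sub.
  apply: (sumsmx_sup (~: ((g1 * h)%g @: C1))); first by apply: sub_E; rewrite setSI // subsetUl.
  apply: (sumsmx_sup (~: ((g2 * h)%g @: C2))); first by apply: sub_E; rewrite setSI // subsetUr.
  rewrite genmxE /V !setCK submxMr // tprod_sub //.
    exact: (localized_translate_sub loc1).
  exact: (localized_translate_sub loc2).
apply: leq_trans (mxrankS sub) _; apply: leq_trans (mxrank_sum_leqif _) _ => /=.
rewrite -card_powerset -mulnA -sum_nat_const; apply: leq_sum => D _.
rewrite -sum_nat_const; apply: leq_sum => D' _.
by rewrite genmxE rank_leq_row.
Qed.

End Localized.

(** * Combinatorics of Young tableaux *)

Section Counting.
Variables (T : finType) (f : T -> nat) (A : {set T}).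

Lemma card_le_inj j : {in A &, injective f} -> (forall x, x \in A -> f x < j)%N ->
  (#|A| <= j)%N.
Proof.
move=> injf ltf; rewrite cardE -(size_map f) -(size_iota 0 j); apply: uniq_leq_size.
  by rewrite map_inj_in_uniq ?enum_uniq // => x y; rewrite !mem_enum; apply: injf.
by move=> i /mapP[x]; rewrite mem_enum mem_iota => Ax ->; rewrite ltf.
Qed.

Lemma card_ge_surj j : (forall i, (i < j)%N -> exists2 x, x \in A & f x = i) ->
  (j <= #|A|)%N.
Proof.
move=> surjf; rewrite cardE -(size_map f) -[leqLHS](size_iota 0 j).
apply: uniq_leq_size (iota_uniq _ _) _ => i; rewrite mem_iota => /= /surjf[x Ax <-].
by apply: map_f; rewrite mem_enum.
Qed.

Lemma card_sum_fibers : #|A| = (\sum_(i < (\max_x f x).+1) #|[set x in A | f x == i]|)%N.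
Proof.
rewrite -sum1_card (partition_big (fun x => inord (f x) : 'I_(\max_x f x).+1) predT) //=.
apply: eq_bigr => i _; rewrite -sum1_card; apply: eq_bigl => x; rewrite inE; congr (_ && _).
by rewrite -val_eqE /= inordK // ltnS leq_bigmax.
Qed.

End Counting.

Section Tableau.
Variable T : finType.
Implicit Types (r c : T -> nat) (p q g : {perm T}).

(** The entry x sits in row r x and column c x: cells have one entry, and the
    cells form a Young diagram, that is, a down-closed set of pairs.  The shape
    is not recorded, which makes the transpose the mere exchange of r and c. *)
Definition young_tableau r c : Prop :=
  (forall x y, r x = r y -> c x = c y -> x = y) /\
  (forall x i j, (i <= r x)%N -> (j <= c x)%N -> exists2 y, r y = i & c y = j).

Lemma young_tableau_transpose r c : young_tableau r c -> young_tableau c r.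
Proof.
case=> inj down; split=> [x y eqc eqr | x j i lej lei]; first exact: inj.
by have [y] := down x i j lei lej; exists y.
Qed.

(** The row group or the column group, according to the function. *)
Definition fiber_stab r : {set {perm T}} := [set p : {perm T} | [forall x, r (p x) == r x]].

Lemma fiber_stabP r p : reflect (forall x, r (p x) = r x) (p \in fiber_stab r).
Proof. by rewrite inE; apply: (iffP forallP) => rp x; apply/eqP. Qed.

Lemma fiber_stab_group_set r : group_set (fiber_stab r).
Proof.
apply/group_setP; split=> [|p q /fiber_stabP rp /fiber_stabP rq].
  by apply/fiber_stabP=> x; rewrite perm1.
by apply/fiber_stabP=> x; rewrite permM rq rp.
Qed.
Canonical fiber_stab_group r : {group {perm T}} := Group (fiber_stab_group_set r).

Lemma fiber_stab_tperm r x y : r x = r y -> tperm x y \in fiber_stab r.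
Proof. by move=> rxy; apply/fiber_stabP=> z; case: tpermP => [->|->|]. Qed.

Section Straighten.
Variables (r c : T -> nat).
Hypothesis tab : young_tableau r c.
Let row_len i := #|[set x | r x == i]|.

Let cell_bound x : (c x < row_len (r x))%N.
Proof.
apply: (@card_ge_surj _ c) => j; rewrite ltnS => lejx.
by have [y ry cy] := proj2 tab x (r x) j (leqnn _) lejx; exists y; rewrite ?inE ?ry.
Qed.

Let cell_exists i j : (j < row_len i)%N -> exists2 x, r x = i & c x = j.
Proof.
move=> ltj; have [/existsP[x /andP[/eqP rx /eqP cx]] | no] :=
  boolP [exists x, (r x == i) && (c x == j)]; first by exists x.
suff: (row_len i <= j)%N by rewrite leqNgt ltj.
apply: (@card_le_inj _ c) => [x y|x]; rewrite !inE.
  by move=> /eqP rx /eqP ry; apply: (proj1 tab); rewrite rx.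
move=> /eqP rx; rewrite ltnNge; apply: contra no => lejx.
have [y ry cy] := proj2 tab x i j (eq_leq (esym rx)) lejx.
by apply/existsP; exists y; rewrite ry cy !eqxx.
Qed.

(** If g sends entries of a common row to different columns, then the columns
    c (g x) can be reached by a permutation of each row.  One has to see that the
    column c (g x) meets the row of x.  For each j, every row i contains at most
    min(row_len i, j) entries x with c (g x) < j, while it contains exactly that
    number of entries with c x < j; the total numbers agree, hence so does each
    row.  With j the length of row i, all entries of row i have c (g x) < j. *)
Lemma young_tableau_straighten g :
  (forall x y, r x = r y -> c (g x) = c (g y) -> x = y) ->
  exists2 p, p \in fiber_stab r & forall x, c (p x) = c (g x).
Proof.
move=> inj_g.
have bound x0 : (c (g x0) < row_len (r x0))%N.
  rewrite ltnNge; apply/negP; set j := row_len _ => lejx0.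
  pose S f := [set x : T | (c (f x) < j)%N].
  have eqS : #|S g| = #|S id|.
    rewrite -(card_imset (S g) (@perm_inj _ g)); apply: eq_card => x.
    apply/imsetP/idP=> [[y Sy ->] | Sx]; first by move: Sy; rewrite !inE.
    by exists (g^-1%g x); rewrite ?permKV //; move: Sx; rewrite !inE permKV.
  pose row f i := [set x in S f | r x == i].
  have le_row i : (#|row g i| <= #|row id i|)%N.
    apply: (@leq_trans (minn (row_len i) j)).
      rewrite leq_min; apply/andP; split.
        by apply: subset_leq_card; apply/subsetP=> x; rewrite !inE => /andP[].
      apply: (@card_le_inj _ (c \o g)) => [x y|x]; rewrite !inE /=; last by case/andP.
      by move=> /andP[_ /eqP rx] /andP[_ /eqP ry]; apply: inj_g; rewrite rx.
    apply: (@card_ge_surj _ c) => l; rewrite leq_min => /andP[/cell_exists[x rx cx] ltlj].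
    by exists x; rewrite // !inE cx ltlj rx eqxx.
  have lt_row : (#|row g (r x0)| < #|row id (r x0)|)%N.
    apply: (@leq_trans j); last first.
      apply: (@card_ge_surj _ c) => l ltlj; have [x rx cx] := cell_exists ltlj.
      by exists x; rewrite // !inE cx ltlj rx eqxx.
    rewrite /j /row_len (cardsD1 x0 [set x | _]) !inE eqxx ltnS.
    apply: subset_leq_card; apply/subsetP=> x; rewrite !inE => /andP[ltx ->].
    by rewrite andbT; apply: contraTneq ltx => ->; rewrite -leqNgt.
  have := eqS; rewrite (card_sum_fibers r (S g)) (card_sum_fibers r (S id)) => /eqP.
  apply/negP; rewrite neq_ltn; apply/orP; left.
  have ltx0 : (r x0 < (\max_x r x).+1)%N by rewrite ltnS leq_bigmax.
  rewrite (bigD1 (Ordinal ltx0)) // [ltnRHS](bigD1 (Ordinal ltx0)) //=.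
  by rewrite -addSn; apply: leq_add; [exact: lt_row | apply: leq_sum => i _; exact: le_row].
pose f x := odflt x [pick z | (r z == r x) && (c z == c (g x))].
have fP x : r (f x) = r x /\ c (f x) = c (g x).
  rewrite /f; case: pickP => [z /andP[/eqP-> /eqP->] // | no].
  by have [z rz cz] := cell_exists (bound x); have := no z; rewrite rz cz !eqxx.
have inj_f : injective f.
  by move=> x y eqf; apply: inj_g; [case: (fP x) => <- _; case: (fP y) => <- _
                                   | case: (fP x) => _ <-; case: (fP y) => _ <-]; rewrite eqf.
exists (perm inj_f); last by move=> x; rewrite permE; case: (fP x).
by apply/fiber_stabP=> x; rewrite permE; case: (fP x).
Qed.

End Straighten.

(** Either g is a product of a column and a row permutation, or some transposition
    is both in the row group and, after conjugation, in the column group. *)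
Lemma young_tableau_double_coset r c g : young_tableau r c ->
  (exists q p, [/\ q \in fiber_stab c, p \in fiber_stab r & g = (q * p)%g]) \/
  (exists t, [/\ t \in fiber_stab r, odd_perm t & (t ^ g^-1)%g \in fiber_stab c]).
Proof.
move=> tab.
have [/existsP[x /existsP[y]] | no] :=
    boolP [exists x, [exists y, [&& r x == r y, c (g^-1%g x) == c (g^-1%g y) & x != y]]].
  case/and3P=> /eqP rxy /eqP cxy ne_xy; right; exists (tperm x y).
  by rewrite fiber_stab_tperm // odd_tperm ne_xy tpermJ fiber_stab_tperm.
left; have [x y rxy cxy | p rp cp] := @young_tableau_straighten r c tab g^-1%g.
  apply/eqP; apply: contraNT no => ne_xy.
  by apply/existsP; exists x; apply/existsP; exists y; rewrite rxy cxy !eqxx.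
exists (g * p)%g, p^-1%g; split; last by rewrite mulgK.
  by apply/fiber_stabP=> x; rewrite permM cp permK.
by rewrite groupV.
Qed.

Lemma fiber_stab_TI r c p : young_tableau r c ->
  p \in fiber_stab r -> p \in fiber_stab c -> p = 1%g.
Proof.
move=> [inj _] /fiber_stabP rp /fiber_stabP cp; apply/permP=> x; rewrite perm1.
exact: inj.
Qed.

End Tableau.

(** * Young symmetrizers and their right ideals *)

Section RegularCoordinates.
Variable gT : finGroupType.
Local Notation G := [set: gT].
Local Notation aG := (regular_repr algC G).
Implicit Types (x y g : gT) (u : 'rV[algC]_(gcard G)) (M : 'M[algC]_(gcard G)).

(** Row vectors of the regular representation are functions on the group. *)
Definition coef u x : algC := u 0 (gring_index G x).

Lemma coef_scale k u x : coef (k *: u) x = k * coef u x.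
Proof. by rewrite /coef mxE. Qed.

Lemma coef_eq0 u : (forall x, coef u x = 0) -> u = 0.
Proof.
move=> u0; apply/rowP=> i; rewrite mxE -(gring_valK i); exact: u0.
Qed.

Lemma gring_index_eq x y : (gring_index G x == gring_index G y) = (x == y).
Proof. by rewrite (inj_in_eq (can_in_inj (@gring_indexK _ _))) ?inE. Qed.

Lemma regular_reprE g i y :
  aG g i (gring_index G y) = (y == enum_val i * g)%g%:R.
Proof. by rewrite /= /regular_mx !mxE eqxx gring_index_eq. Qed.

Lemma coef_mul u g x : coef (u *m aG g) x = coef u (x * g^-1).
Proof.
rewrite /coef mxE (bigD1 (gring_index G (x * g^-1)%g)) //= big1 => [|i ne_i].
  by rewrite addr0 regular_reprE gring_indexK ?inE // mulgKV eqxx mulr1.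
rewrite regular_reprE -(can2_eq (mulgKV g) (mulgK g)) eq_sym.
rewrite -(inj_eq (can_inj (@gring_valK _ _))) in ne_i.
by rewrite gring_indexK ?inE // in ne_i; rewrite (negPf ne_i) mulr0.
Qed.

(** The matrix of right multiplication by an element of the group ring has its
    entry at (x, y) given by the coefficient of that element at x^-1 y. *)
Lemma gring_coef M x y : (M \in group_ring algC G)%MS ->
  M (gring_index G x) (gring_index G y) = coef (gring_row M) (x^-1 * y).
Proof.
case/envelop_mxP=> a ->; rewrite /coef /gring_row mxE !summxE; apply: eq_bigr => g _.
rewrite mxE [in RHS]mxE !regular_reprE !gring_indexK ?inE // mul1g.
by rewrite (can2_eq (mulKVg x) (mulKg x)).
Qed.

Lemma coef_gring_left M x k : (M \in group_ring algC G)%MS ->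
  aG x *m M = k *: M -> forall y, coef (gring_row M) (x^-1 * y) = k * coef (gring_row M) y.
Proof.
move=> RM xM y; rewrite -gring_coef //.
have := congr1 (fun N => coef (gring_row N) y) xM; rewrite linearZ coef_scale => <-.
rewrite gring_row_mul /coef /gring_row rowK gring_indexK ?inE // mul1g.
by rewrite -rowE mxE.
Qed.

Lemma mxtrace_gring M : (M \in group_ring algC G)%MS ->
  \tr M = #|G|%:R * coef (gring_row M) 1.
Proof.
move=> RM; rewrite /mxtrace (eq_bigr (fun=> coef (gring_row M) 1)) => [|i _].
  by rewrite sumr_const card_ord mulr_natl.
by rewrite -(gring_valK i) gring_coef // mulVg.
Qed.

Lemma gring_row_eq0 M : (M \in group_ring algC G)%MS -> gring_row M = 0 -> M = 0.
Proof. by move=> RM M0; rewrite -(gring_rowK RM) M0 linear0. Qed.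

(** Semisimplicity of the group ring: for each x the product of M by the inverse
    of x has square zero, hence trace zero, and this trace is the coefficient of
    M at x, up to the factor #|G|. *)
Lemma gring_sq0_eq0 M : (M \in group_ring algC G)%MS ->
  (forall N, (N \in group_ring algC G)%MS -> M *m N *m M = 0) -> M = 0.
Proof.
move=> RM M2; apply: gring_row_eq0 => //; apply: coef_eq0 => x.
have Rx : (aG x^-1%g \in group_ring algC G)%MS by rewrite envelop_mx_id ?inE.
have RMx : (M *m aG x^-1%g \in group_ring algC G)%MS by rewrite envelop_mxM.
have := @mxtrace_quasi_idempotent _ _ (M *m aG x^-1%g) 0.
rewrite mulmxA M2 // mul0mx scale0r mul0r mxtrace_gring // gring_row_mul coef_mul => /(_ erefl).
by rewrite invgK mul1g => /eqP; rewrite mulf_eq0 pnatr_eq0 -leqn0 leqNgt cardG_gt0 => /eqP.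
Qed.

End RegularCoordinates.

Section YoungIdeal.
Variables (T : finType) (r c : T -> nat) (s : bool).
Local Notation G := [set: {perm T}].
Local Notation aG := (regular_repr algC G).
Local Notation R_G := (group_ring algC G).

(** The Young symmetrizer is normalized as a product of two projections.  For
    s = false rows are symmetrized and columns antisymmetrized, for s = true the
    converse. *)
Definition row_proj : 'M[algC]_(gcard G) := twisted_proj (fiber_stab_group r) s aG.
Definition col_proj : 'M[algC]_(gcard G) := twisted_proj (fiber_stab_group c) (~~ s) aG.
Definition young_proj := col_proj *m row_proj.
Definition young_vec := gring_row young_proj.
Definition young_ideal := cyclic_mx aG young_vec.
Local Notation a := row_proj.
Local Notation b := col_proj.
Local Notation L := young_proj.

Hypothesis tab : young_tableau r c.

Lemma row_proj_gring : (a \in R_G)%MS.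
Proof. exact: twisted_proj_envelop. Qed.

Lemma col_proj_gring : (b \in R_G)%MS.
Proof. exact: twisted_proj_envelop. Qed.

Lemma young_proj_gring : (L \in R_G)%MS.
Proof. by rewrite envelop_mxM ?row_proj_gring ?col_proj_gring. Qed.

(** For a group element of the form q p, the factors q and p are absorbed.  For
    any other one there is a transposition t in the row group whose conjugate is
    in the column group; it acts by opposite signs from the two sides, so the
    product vanishes. *)
Lemma young_sandwich M : (M \in R_G)%MS -> exists k, b *m M *m a = k *: L.
Proof.
case/envelop_mxP=> f ->; rewrite mulmx_sumr mulmx_suml.
suff H g : exists k, b *m aG g *m a = k *: L.
  have [k kP] := fin_all_exists H.
  exists (\sum_(g in G) f g * k g); rewrite scaler_suml; apply: eq_bigr => g _.
  by rewrite -(scalemxAr (f g)) -(scalemxAl (f g)) kP scalerA.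
have [[q [p [Cq Rp ->]]] | [t [Rt odd_t Ct]]] := young_tableau_double_coset g tab.
  exists (twist (~~ s) q * twist s p); rewrite repr_mxM ?inE // mulmxA -mulmxA.
  rewrite /b /a twisted_proj_absorb // twisted_proj_absorb_r //.
  by rewrite -scalemxAl -scalemxAr scalerA.
exists 0; rewrite scale0r; apply/eqP; set X := (X in X == 0).
suff: 2%:R *: X == 0 by rewrite scaler_eq0 pnatr_eq0.
rewrite scaler_nat mulr2n addr_eq0 {}/X; apply/eqP.
have tt : aG t *m a = twist s t *: a by rewrite /a twisted_proj_absorb.
have ct : b *m aG (t ^ g^-1)%g = twist (~~ s) t *: b.
  by rewrite /b twisted_proj_absorb_r // /twist odd_permJ.
have bt : b *m aG g *m aG t = twist (~~ s) t *: (b *m aG g).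
  by rewrite -mulmxA -repr_mxM ?inE // conjgCV repr_mxM ?inE // mulmxA ct -scalemxAl.
have sgn_t : twist s t * twist (~~ s) t = -1.
  by rewrite /twist odd_t; case: (s); rewrite ?mulr1 ?mul1r.
rewrite -scaleN1r -sgn_t -scalerA (scalemxAl (twist (~~ s) t)) -bt
  -[_ *m aG t *m a]mulmxA tt.
by rewrite -(scalemxAr (twist s t)) scalerA twist_sqr scale1r.
Qed.

Lemma young_proj_corner M : (M \in R_G)%MS -> exists k, L *m M *m L = k *: L.
Proof.
move=> RM; have [|k] := @young_sandwich (a *m M *m b).
  by rewrite !envelop_mxM ?row_proj_gring ?col_proj_gring.
by rewrite /young_proj !mulmxA => ->; exists k.
Qed.

Lemma young_projE :
  L = (#|fiber_stab c|%:R^-1 * #|fiber_stab r|%:R^-1) *: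
      \sum_(q in fiber_stab c) \sum_(p in fiber_stab r)
         (twist (~~ s) q * twist s p) *: aG (q * p)%g.
Proof.
rewrite /young_proj /col_proj /row_proj /twisted_proj -scalemxAl -scalemxAr scalerA.
congr (_ *: _); rewrite mulmx_suml; apply: eq_bigr => q _.
rewrite mulmx_sumr; apply: eq_bigr => p _.
by rewrite -scalemxAl -scalemxAr scalerA -repr_mxM ?inE.
Qed.

Lemma coef_young g : coef young_vec g =
  (#|fiber_stab c|%:R^-1 * #|fiber_stab r|%:R^-1) *
  \sum_(q in fiber_stab c) \sum_(p in fiber_stab r)
     twist (~~ s) q * twist s p * (g == q * p)%g%:R.
Proof.
rewrite /young_vec young_projE linearZ coef_scale /coef mxE summxE; congr (_ * _).
apply: eq_bigr => q _; rewrite summxE; apply: eq_bigr => p _.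
by rewrite mxE regular_reprE gring_indexK ?inE // mul1g.
Qed.

Lemma young_coef1_neq0 : coef young_vec 1 != 0.
Proof.
rewrite coef_young mulf_neq0 ?mulf_neq0 ?invr_eq0 ?pnatr_eq0 -?lt0n ?cardG_gt0 //.
rewrite (bigD1 1%g) ?group1 //= (bigD1 1%g) ?group1 //= !twist1 mulg1 eqxx !mulr1.
rewrite !big1 ?addr0 ?oner_eq0 // => [q /andP[Cq q1] | p /andP[_ p1]].
  rewrite big1 // => p Rp; case: eqP => [eq1 | _]; last by rewrite mulr0.
  case/eqP: q1; apply: (fiber_stab_TI tab) Cq.
  by rewrite -(mulgK p q) -eq1 mul1g groupV.
by rewrite mul1g eq_sym (negPf p1) mulr0.
Qed.

Lemma young_coef_support g : coef young_vec g != 0 ->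
  exists q p, [/\ q \in fiber_stab c, p \in fiber_stab r & g = (q * p)%g].
Proof.
rewrite coef_young mulf_eq0 negb_or => /andP[_ nz].
have [/existsP[q /existsP[p /and3P[Cq Rp /eqP ->]]] | no] := boolP [exists q, [exists p,
  [&& q \in fiber_stab c, p \in fiber_stab r & g == (q * p)%g]]].
  by exists q, p.
case/eqP: nz; apply: big1 => q Cq; apply: big1 => p Rp; case: eqP => [def_g|].
  by case/existsP: no; exists q; apply/existsP; exists p; rewrite Cq Rp def_g eqxx.
by rewrite mulr0.
Qed.

(** The trace of right multiplication by the symmetrizer is a nonzero multiple of
    its coefficient at 1, which excludes square zero. *)
Lemma young_proj_sq : exists2 k, k != 0 & L *m L = k *: L.
Proof.
have [|k] := @young_proj_corner 1%:M; first exact: envelop_mx1.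
rewrite mulmx1 => LL; exists k => //.
have := mxtrace_quasi_idempotent LL; rewrite mxtrace_gring ?young_proj_gring //.
apply: contra_eq_neq => ->; rewrite mul0r mulf_neq0 ?young_coef1_neq0 //.
by rewrite pnatr_eq0 -lt0n cardG_gt0.
Qed.

Lemma young_vec_neq0 : young_vec != 0.
Proof. by apply: contraNneq young_coef1_neq0 => ->; rewrite /coef mxE. Qed.

(** A nonzero w in the ideal is L A with A in the group ring.  If w g L were zero
    for all g, then M N M = L A N L A would vanish for M = L A and all N,
    contradicting semisimplicity.  Otherwise w g L is a nonzero multiple of L,
    so w generates the ideal. *)
Lemma young_ideal_simple : mxsimple aG young_ideal.
Proof.
split; rewrite ?cyclic_mx_module ?cyclic_mx_eq0 ?young_vec_neq0 // => W modW sWV nzW.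
have /rowV0Pn[w sw nz_w] := nzW.
have [A RA def_w] := cyclic_mxP (submx_trans sw sWV).
pose M := L *m A; have RM : (M \in R_G)%MS by rewrite envelop_mxM ?young_proj_gring.
have nzM : M != 0.
  by apply: contraNneq nz_w => M0; rewrite def_w /young_vec -gring_row_mul -/M M0 linear0.
have [/forallP zM | ] := boolP [forall g : {perm T}, M *m aG g *m L == 0].
  case/eqP: nzM; apply: gring_sq0_eq0 => // N /envelop_mxP[f ->].
  rewrite mulmx_sumr mulmx_suml big1 // => g _.
  by rewrite -(scalemxAr (f g)) -(scalemxAl (f g)) /M mulmxA (eqP (zM g)) mul0mx scaler0.
rewrite negb_forall => /existsP[g nz].
have [k MgL] : exists k, M *m aG g *m L = k *: L.
  rewrite /M -(mulmxA L A); apply: young_proj_corner.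
  by rewrite envelop_mxM // envelop_mx_id ?inE.
have nzk : k != 0 by apply: contraNneq nz => k0; rewrite MgL k0 scale0r.
apply: cyclic_mx_sub => //.
have -> : young_vec = k^-1 *: (w *m (aG g *m L)).
  rewrite def_w /young_vec -!gring_row_mul mulmxA -/M MgL linearZ scalerA mulVf //.
  by rewrite scale1r.
rewrite scalemx_sub // (mxmodule_envelop modW) //.
by rewrite envelop_mxM ?young_proj_gring ?envelop_mx_id ?inE.
Qed.

End YoungIdeal.

(** * Young ideals are localized *)

Section YoungLocal.
Variables (T : finType) (r c : T -> nat) (s : bool).
Local Notation G := [set: {perm T}].
Local Notation aG := (regular_repr algC G).
Local Notation R_G := (group_ring algC G).
Local Notation v := (young_vec r c s).
Local Notation V := (young_ideal r c s).

Definition first_row : {set T} := [set x | r x == 0].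
Local Notation C := first_row.

(** The span of the translates of the symmetrizer by the permutations that fix
    the first row pointwise. *)
Definition local_span : 'M[algC]_(gcard G) :=
  (\sum_(g | perm_on (~: C) g) <<v *m aG g>>)%MS.
Local Notation U := local_span.

Lemma perm_on_first_row h : perm_on C h -> h \in fiber_stab r.
Proof.
move=> hC; apply/fiber_stabP=> x; have [Cx | C'x] := boolP (x \in C).
  have: h x \in C by rewrite perm_closed.
  by move: Cx; rewrite !inE => /eqP-> /eqP.
by rewrite (out_perm hC).
Qed.

Lemma local_span_fix m (W : 'M_(m, gcard G)) h : (W <= U)%MS -> perm_on C h ->
  W *m aG h = twist s h *: W.
Proof.
move=> sWU hC; apply/eqP; rewrite -subr_eq0 -mul_mx_scalar -mulmxBr.
apply/eqP/sub_kermxP; apply: submx_trans sWU _; apply/sumsmx_subP=> g gA.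
rewrite genmxE; apply/sub_kermxP; rewrite mulmxBr mul_mx_scalar -mulmxA -repr_mxM ?inE //.
have -> : (g * h = h * g)%g.
  apply: perm_onC gA hC _; rewrite -setI_eq0; apply/eqP/setP=> x.
  by rewrite !inE andNb.
rewrite repr_mxM ?inE // mulmxA; set e := v *m aG h.
have -> : e = twist s h *: v.
  rewrite /e /young_vec -gring_row_mul /young_proj -mulmxA twisted_proj_absorb_r.
    by rewrite -scalemxAr linearZ.
  exact: perm_on_first_row.
by rewrite -scalemxAl subrr.
Qed.

Lemma local_span_stable h : perm_on (~: C) h -> (U *m aG h <= U)%MS.
Proof.
move=> hA; rewrite sumsmxMr; apply/sumsmx_subP=> g gA.
apply: (sumsmx_sup (g * h)%g); first exact: perm_onM.
by rewrite (eqmxMr _ (genmxE _)) genmxE -mulmxA -repr_mxM ?inE.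
Qed.

Lemma young_vec_local : (v <= U)%MS.
Proof.
by apply: (sumsmx_sup 1%g); rewrite ?perm_on1 // genmxE repr_mx1 mulmx1.
Qed.

Lemma local_span_sub : (U <= V)%MS.
Proof.
apply/sumsmx_subP=> g _; rewrite genmxE mxmodule_trans ?inE ?cyclic_mx_module //.
exact: cyclic_mx_id.
Qed.

Lemma local_span_generates : (V <= \sum_g <<U *m aG g>>)%MS.
Proof.
apply: cyclic_mx_sub; last first.
  by apply: (sumsmx_sup 1%g) => //; rewrite genmxE repr_mx1 mulmx1 young_vec_local.
apply/mxmoduleP=> x _; rewrite sumsmxMr; apply/sumsmx_subP=> g _.
apply: (sumsmx_sup (g * x)%g) => //.
by rewrite (eqmxMr _ (genmxE _)) genmxE -mulmxA -repr_mxM ?inE.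
Qed.

Definition young_repr := submod_repr (cyclic_mx_module aG v).
Definition local_rows : 'M_(\rank U, \rank V) := in_submod V (row_base U).

Lemma local_rows_free : row_free local_rows.
Proof.
have sUV : (row_base U <= V)%MS by rewrite eq_row_base local_span_sub.
by rewrite /row_free /local_rows mxrank_in_submod // eq_row_base.
Qed.

Lemma local_rows_localized : localized young_repr s C local_rows.
Proof.
have sUV : (row_base U <= V)%MS by rewrite eq_row_base local_span_sub.
have UJ h : local_rows *m young_repr h = in_submod V (row_base U *m aG h).
  by rewrite /local_rows (in_submodJ (cyclic_mx_module aG v) _ sUV).
split=> [h hC | h hA | ].
- by rewrite UJ local_span_fix ?eq_row_base // linearZ.
- have: (row_base U *m aG h <= row_base U)%MS.
    by rewrite (eqmxMr _ (eq_row_base _)) eq_row_base local_span_stable.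
  by rewrite UJ => /submxP[B ->]; rewrite in_submodE -mulmxA -in_submodE submxMl.
rewrite -(val_submodS (U := V)) val_submod1 [X in (_ <= X)%MS]val_submodE sumsmxMr_gen.
apply: submx_trans local_span_generates _; apply/sumsmx_subP=> g _.
apply: (sumsmx_sup g) => //; rewrite !genmxE (eqmxMr _ (genmxE _)) -val_submodE UJ.
rewrite in_submodK ?(eqmxMr _ (eq_row_base _)) //.
by rewrite mxmodule_trans ?inE ?cyclic_mx_module ?local_span_sub.
Qed.

End YoungLocal.

(** * The degree of a Young ideal *)

(** Vanishing at x is a linear condition, so it can be tested on summands. *)
Lemma coef_sum_eq0 (gT : finGroupType) (I : finType) (P : pred I) n
    (B : I -> 'M[algC]_(n, gcard [set: gT])) m
    (W : 'M_(m, gcard [set: gT])) (u : 'rV_(gcard [set: gT])) x :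
  (W <= \sum_(i | P i) <<B i>>)%MS ->
  (forall i (w : 'rV_(gcard [set: gT])), P i -> (w <= B i)%MS -> coef w x = 0) ->
  (u <= W)%MS -> coef u x = 0.
Proof.
move=> sW B0 /submx_trans/(_ sW) sub.
suff: (u <= kermx (delta_mx (gring_index [set: gT] x) 0 : 'cV[algC]_(gcard [set: gT])))%MS.
  by move/sub_kermxP/matrixP/(_ 0 0); rewrite -colE !mxE.
apply: submx_trans sub _; apply/sumsmx_subP=> i Pi; rewrite genmxE.
apply/sub_kermxP; rewrite -colE; apply/colP=> j; rewrite !mxE.
have := B0 i (row j (B i)) Pi (row_sub j _); by rewrite /coef mxE.
Qed.

Section YoungDegree.
Variables (T : finType) (r c : T -> nat) (s : bool).
Hypothesis tab : young_tableau r c.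
Local Notation G := [set: {perm T}].
Local Notation aG := (regular_repr algC G).
Local Notation v := (young_vec r c s).
Local Notation V := (young_ideal r c s).
Local Notation C := (first_row r).
Local Notation U := (local_span r c s).
Implicit Types (u : 'rV[algC]_(gcard G)) (g : {perm T}).

(** Right translations commute with the left action of the column group. *)
Lemma coef_young_ideal_left u q g : (u <= V)%MS -> q \in fiber_stab c ->
  coef u (q * g) = twist (~~ s) q * coef u g.
Proof.
move=> /cyclic_mxP[A RA ->] Cq; rewrite /young_vec -gring_row_mul.
have := @coef_gring_left _ (young_proj r c s *m A) q^-1 (twist (~~ s) q).
rewrite invgK; apply.
  by rewrite envelop_mxM ?young_proj_gring.
rewrite /young_proj !mulmxA /col_proj twisted_proj_absorb ?groupV // twistV.
by rewrite -!scalemxAl.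
Qed.

Lemma coef_local_span_support u g : (u <= U)%MS -> coef u g != 0 ->
  exists q p h, [/\ q \in fiber_stab c, p \in fiber_stab r, perm_on (~: C) h
                  & g = (q * p * h)%g].
Proof.
move=> sU nz.
have [/existsP[q /existsP[p /existsP[h /and4P[Cq Rp hA /eqP ->]]]] | no] :=
  boolP [exists q : {perm T},
  [exists p : {perm T}, [exists h : {perm T},
  [&& q \in fiber_stab c, p \in fiber_stab r, perm_on (~: C) h & g == (q * p * h)%g]]]].
  by exists q, p, h.
case/eqP: nz; apply: (coef_sum_eq0 (submx_refl _)) sU => h w hA /sub_rVP[k ->].
rewrite coef_scale coef_mul; apply/eqP; rewrite mulf_eq0; apply/orP; right.
apply: contraNT no => /young_coef_support[q [p [Cq Rp def_g]]].
apply/existsP; exists q; apply/existsP; exists p; apply/existsP; exists h.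
by rewrite Cq Rp hA -def_g mulgKV eqxx.
Qed.

Lemma fiber_stab_first_row p : p \in fiber_stab r -> p @: C = C.
Proof.
move=> /fiber_stabP rp; apply/eqP; rewrite eqEcard card_imset ?leqnn ?andbT; last exact: perm_inj.
by apply/subsetP=> _ /imsetP[x Cx ->]; move: Cx; rewrite !inE rp.
Qed.

(** The support of u consists of products q p h with q a column permutation, p a
    row permutation and h fixing the first row.  Split p as l k with l acting on
    the first row and k on the other ones: l commutes with k h and acts on u from
    the right by a sign, as q does from the left, so the value at q p h is up to
    sign the value at k h. *)
Lemma coef_local_span_inj u : (u <= U)%MS ->
  (forall h, perm_on (~: C) h -> coef u h = 0) -> u = 0.
Proof.
move=> sU u0; apply: coef_eq0 => g; apply/eqP; apply: contraT => nz.
have [q [p [h [Cq Rp hA def_g]]]] := coef_local_span_support sU nz.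
have [l [k [lC kA def_p]]] := perm_stabilizer_split (fiber_stab_first_row Rp).
have comm x : perm_on (~: C) x -> (l * x = x * l)%g.
  move=> xA; apply: perm_onC lC xA _; rewrite -setI_eq0; apply/eqP/setP=> y.
  by rewrite !inE andbN.
move: nz; rewrite def_g def_p -!mulgA coef_young_ideal_left //; last first.
  exact: submx_trans sU (local_span_sub _ _ _).
rewrite mulf_eq0 comm ?perm_onM // -(invgK l) -coef_mul.
rewrite (local_span_fix sU) ?perm_onV // coef_scale u0 ?perm_onM //.
by rewrite !mulr0 eqxx orbT.
Qed.

(** The entries of the first row that are not alone in their column. *)
Definition covered_row : {set T} := [set x in C | [exists y in ~: C, c y == c x]].
Local Notation T0 := covered_row.

Lemma covered_row_sub : T0 \subset C.
Proof. by apply/subsetP=> x; rewrite inE => /andP[]. Qed.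

Lemma card_covered_row : (#|T0| <= #|~: C|)%N.
Proof.
pose f x := odflt x [pick y in ~: C | c y == c x].
have fP x : x \in T0 -> f x \in ~: C /\ c (f x) = c x.
  rewrite inE /f => /andP[_ /exists_inP[y Ay cy]].
  by case: pickP => [z /andP[Az /eqP] // | /(_ y)]; rewrite Ay cy.
rewrite -(card_in_imset (f := f)) => [|x y T0x T0y eqf].
  by apply: subset_leq_card; apply/subsetP=> _ /imsetP[x /fP[Ax _] ->].
apply: (proj1 tab); last by rewrite -(proj2 (fP x T0x)) -(proj2 (fP y T0y)) eqf.
have:= subsetP covered_row_sub _ T0x; have:= subsetP covered_row_sub _ T0y.
by rewrite !inE => /eqP-> /eqP->.
Qed.

(** The contents to be put below the first row while the covered entries stay in
    place. *)
Definition lower_sets : {set {set T}} :=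
  [set X : {set T} | X \subset ~: T0 & #|X| == #|~: C|].

Lemma exists_carrier X : X \in lower_sets ->
  exists g, perm_on (~: T0) g && (g @: (~: C) == X).
Proof.
rewrite inE => /andP[sX /eqP cardX].
have sA : ~: C \subset ~: T0 by rewrite setCS covered_row_sub.
have [g gT gX] := perm_moving_onto sA sX (esym cardX).
by exists g; rewrite gT gX eqxx.
Qed.

Definition carrier X : {perm T} :=
  odflt 1%g [pick g | perm_on (~: T0) g && (g @: (~: C) == X)].

Lemma carrierP X : X \in lower_sets -> perm_on (~: T0) (carrier X) /\ carrier X @: (~: C) = X.
Proof.
move=> /exists_carrier[g gP]; rewrite /carrier; case: pickP => [h /andP[hT /eqP] //|].
by move/(_ g); rewrite gP.
Qed.

(** If h g_X g_Y^-1 = q p l, then a point x sent to z in Y by h g_X has q x below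
    the first row.  If x itself were in the first row, it would be a covered
    entry, hence fixed by h and g_X, so z = x would be a covered entry in Y.
    Therefore x is below the first row and z is in X; this gives Y = X. *)
Lemma coef_carrier_disjoint u X Y h : X \in lower_sets -> Y \in lower_sets -> X != Y ->
  perm_on (~: C) h -> (u <= U)%MS -> coef (u *m aG (carrier Y)) (h * carrier X) = 0.
Proof.
move=> LX LY neXY hA sU; have [gXT gXA] := carrierP LX; have [gYT gYA] := carrierP LY.
rewrite coef_mul; apply/eqP; apply: contraNT neXY => nz.
have [q [p [l [Cq Rp lA def_g]]]] := coef_local_span_support sU nz.
rewrite eq_sym eqEcard; move: (LX) (LY); rewrite !inE => /andP[_ /eqP->] /andP[sYT /eqP->].
rewrite leqnn andbT; apply/subsetP=> z Yz.
pose x := (h * carrier X)^-1%g z.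
have hx : (h * carrier X)%g x = z by rewrite permKV.
have qxA : q x \in ~: C.
  have : (q * p * l)%g x \in ~: C.
    rewrite -def_g permM hx; move: Yz; rewrite -{1}gYA => /imsetP[y Ay ->].
    by rewrite permK.
  by rewrite !permM (perm_closed _ lA) !inE (fiber_stabP _ _ Rp).
have [Cx | Ax] := boolP (x \in C); last first.
  have: carrier X (h x) \in carrier X @: (~: C) by rewrite imset_f // perm_closed // inE.
  by rewrite gXA -permM hx.
have T0x : x \in T0.
  rewrite inE Cx; apply/exists_inP; exists (q x) => //.
  by rewrite (fiber_stabP _ _ Cq).
have zx : z = x.
  have h_x : h x = x by apply: (out_perm hA); rewrite in_setC Cx.
  have g_x : carrier X x = x by apply: (out_perm gXT); rewrite in_setC T0x.
  by rewrite -hx permM h_x g_x.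
by have := subsetP sYT _ Yz; rewrite inE zx T0x.
Qed.

(** The translates of the local span to the different lower sets X are in direct
    sum: by the previous lemma only the translate to X contributes to the values
    on the coset of the permutations sending the lower rows to X, and these
    values determine that translate. *)
Lemma young_degree_ge : ('C(#|T| - #|T0|, #|~: C|) * \rank U <= \rank V)%N.
Proof.
have -> : 'C(#|T| - #|T0|, #|~: C|) = #|lower_sets|.
  by rewrite /lower_sets cards_draws (cardsCs (~: T0)) setCK.
pose B X := <<U *m aG (carrier X)>>%MS.
have dx : mxdirect (\sum_(X in lower_sets) B X)%MS.
  apply/mxdirect_sumsP=> X LX; apply/eqP; rewrite -submx0.
  apply/rV_subP=> w; rewrite sub_capmx genmxE => /andP[/submxP[e def_w] sw].
  suff u0 : e *m U = 0 by rewrite def_w mulmxA u0 mul0mx sub0mx.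
  apply: coef_local_span_inj => [|h hA]; first exact: submxMl.
  rewrite -(mulgK (carrier X) h) -coef_mul -mulmxA -def_w.
  apply: (coef_sum_eq0 (submx_refl _)) sw => Y y /andP[LY neYX] /submxP[f ->].
  by rewrite mulmxA coef_carrier_disjoint ?submxMl // eq_sym.
apply: (@leq_trans (\rank (\sum_(X in lower_sets) B X)%MS)).
  rewrite (mxdirectP dx) /= -sum_nat_const leq_sum // => X _.
  by rewrite genmxE mxrankMfree // row_free_unit repr_mx_unit ?inE.
apply: mxrankS; apply/sumsmx_subP=> X _; rewrite genmxE.
by rewrite mxmodule_trans ?inE ?cyclic_mx_module ?local_span_sub.
Qed.

End YoungDegree.

(** * Specht modules of partitions *)

Section Transpose.
Variables (T : finType) (r c : T -> nat) (s : bool).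
Hypothesis tab : young_tableau r c.
Local Notation G := [set: {perm T}].
Local Notation aG := (regular_repr algC G).
Local Notation a := (row_proj r s).
Local Notation b := (col_proj c s).

(** Left multiplication by the row projection a maps b a C[G] to a b C[G]; it is
    not zero since b a b a is a nonzero multiple of b a, so Schur's lemma
    applies. *)
Lemma young_ideal_transpose : mx_iso aG (young_ideal r c s) (young_ideal c r (~~ s)).
Proof.
have Ra := row_proj_gring r s; have Rb := col_proj_gring c s.
have RL := young_proj_gring r c s.
pose f := lin1_mx (gring_row \o (mulmx a \o gring_mx aG)).
have fE u : u *m f = gring_row (a *m gring_mx aG u) by rewrite mul_rV_lin1.
have homf : (1%:M <= dom_hom_mx aG f)%MS.
  apply/hom_mxP=> g Gg; rewrite !mul1mx; apply/row_matrixP=> i.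
  by rewrite !row_mul !rowE !fE gring_mxJ // mulmxA gring_row_mul.
have homV m (W : 'M_(m, gcard G)) : (W <= dom_hom_mx aG f)%MS.
  exact: submx_trans (submx1 _) homf.
have defLT : young_proj c r (~~ s) = a *m b by rewrite /young_proj /col_proj negbK.
have vf : young_vec r c s *m f = gring_row (a *m b *m a).
  by rewrite fE gring_rowK // /young_proj mulmxA.
have imV := hom_cyclic_mx (homV _ (young_vec r c s)); rewrite vf in imV.
apply: mx_Schur_iso (young_ideal_simple s tab)
  (young_ideal_simple (~~ s) (young_tableau_transpose tab)) (homV _ _) _ _.
  rewrite imV; apply: cyclic_mx_sub; first exact: cyclic_mx_module.
  rewrite gring_row_mul -defLT; apply: (mxmodule_envelop (cyclic_mx_module _ _) Ra).
  exact: cyclic_mx_id.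
rewrite -mxrank_eq0 imV mxrank_eq0 cyclic_mx_eq0.
apply/eqP=> /gring_row_eq0 aba0.
have [k nzk LL] := young_proj_sq s tab.
have: k *: young_proj r c s = 0.
  rewrite -LL /young_proj !mulmxA -(mulmxA b) -(mulmxA b) aba0 ?mulmx0 //.
  by rewrite !envelop_mxM.
move/eqP; rewrite scaler_eq0 (negPf nzk) /= => /eqP L0.
by have := young_vec_neq0 s tab; rewrite /young_vec L0 linear0 eqxx.
Qed.

Lemma young_repr_transpose :
  cfRepr (young_repr r c s) = cfRepr (young_repr c r (~~ s)).
Proof. by apply/cfRepr_sim/mx_rsim_iso/young_ideal_transpose. Qed.

End Transpose.

Lemma young_repr_irr (T : finType) (r c : T -> nat) s : young_tableau r c ->
  mx_irreducible (young_repr r c s).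
Proof. by move=> tab; apply/submod_mx_irr/young_ideal_simple. Qed.

(** Termwise, m (d - i) <= d (m - i) for i < d <= m. *)
Lemma expn_le_bin m d : (d <= m)%N -> (m ^ d <= d ^ d * 'C(m, d))%N.
Proof.
move=> ledm; rewrite -(leq_pmul2r (fact_gt0 d)) -mulnA bin_ffact -ffactnn.
rewrite !ffact_prod -{1}[d in (m ^ d)%N]card_ord -{2}[d in (d ^ d)%N]card_ord.
rewrite -!prod_nat_const -!big_split /=; apply: leq_prod => i _.
by rewrite !mulnBr (mulnC m) leq_sub2l // leq_mul2r ledm orbT.
Qed.

Section YoungBound.
Variables (T : finType) (r c : T -> nat) (s : bool).
Hypothesis tab : young_tableau r c.

(** At most half of the points are covered: each of them lies in the first row and
    has its own point below.  So the binomial of the previous degree bound is at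
    least (n / 2 d)^d. *)
Lemma local_rank_bound d : #|~: first_row r| = d ->
  (#|T| ^ d * \rank (local_span r c s) <= 2 ^ d * d ^ d * \rank (young_ideal r c s))%N.
Proof.
move=> cardA; have := young_degree_ge r c s; rewrite cardA => le_deg.
set t := #|covered_row r c| in le_deg.
have led : (t <= d)%N by rewrite -cardA card_covered_row.
have leC : (t <= #|first_row r|)%N by rewrite subset_leq_card ?covered_row_sub.
have cardT : (#|first_row r| + d)%N = #|T| by rewrite -cardA cardsC.
have le2 : (#|T| <= 2 * (#|T| - t))%N.
  by rewrite mul2n -addnn -cardT -{1}(subnK (leq_trans leC (leq_addr d _)))
             leq_add2l leq_subRL ?(leq_trans leC (leq_addr _ _)) // leq_add.
have led' : (d <= #|T| - t)%N by rewrite -cardT -addnBAC // leq_addl.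
rewrite -mulnA; apply: (@leq_trans (2 ^ d * ((#|T| - t) ^ d * \rank (local_span r c s)))).
  rewrite mulnA -expnMn leq_mul2r; apply/orP; right.
  by move: (d) => [|e] //; rewrite leq_exp2r.
rewrite leq_mul2l; apply/orP; right.
apply: (@leq_trans (d ^ d * 'C(#|T| - t, d) * \rank (local_span r c s))).
  by rewrite leq_mul2r expn_le_bin ?orbT.
by rewrite -mulnA leq_mul2l le_deg orbT.
Qed.

End YoungBound.

Section Partition.
Variables (n : nat) (la : seq nat).
Hypothesis la_n : is_partition_of n la.

Definition row_of (i : 'I_n) := reshape_index la i.
Definition col_of (i : 'I_n) := reshape_offset la i.

Let sorted_la : sorted geq la. Proof. by case/and3P: la_n. Qed.
Let la_neq0 : 0%N \notin la. Proof. by case/and3P: la_n. Qed.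
Let sum_la : sumn la = n. Proof. by apply/eqP; case/and3P: la_n. Qed.

Let cell_exists a b : (b < nth 0 la a)%N -> exists2 i : 'I_n, row_of i = a & col_of i = b.
Proof.
move=> ltb; have ltn : (flatten_index la a b < n)%N by rewrite -sum_la flatten_indexP.
exists (Ordinal ltn); rewrite /row_of /col_of /=; first exact: flatten_indexKl.
exact: flatten_indexKr.
Qed.

Let col_bound i : (col_of i < nth 0 la (row_of i))%N.
Proof. by rewrite reshape_offsetP // sum_la. Qed.

Let row_bound i : (row_of i < size la)%N.
Proof. by rewrite reshape_indexP // sum_la. Qed.

Lemma partition_young_tableau : young_tableau row_of col_of.
Proof.
split=> [i j eqr eqc | i a b lea leb].
  apply: val_inj; rewrite /= -(reshape_indexK la i) -(reshape_indexK la j).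
  by move: eqr eqc; rewrite /row_of /col_of => -> ->.
apply: cell_exists; apply: leq_ltn_trans leb _; apply: leq_trans (col_bound i) _.
have geq_trans : transitive geq by move=> x y z /= xy yz; apply: leq_trans yz xy.
have := sorted_leq_nth geq_trans leqnn 0%N sorted_la; apply=> //; rewrite inE //.
exact: leq_ltn_trans lea _.
Qed.

Lemma card_first_row : #|first_row row_of| = head 0%N la.
Proof.
apply/eqP; rewrite eqn_leq -nth0; apply/andP; split.
  apply: (@card_le_inj _ col_of) => [i j|i]; rewrite !inE; last first.
    by move=> /eqP ri; have := col_bound i; rewrite ri.
  by move=> /eqP ri /eqP rj; apply: (proj1 partition_young_tableau); rewrite ri rj.
apply: (@card_ge_surj _ col_of) => b ltb; have [i ri ci] := cell_exists ltb.
by exists i; rewrite // inE ri.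
Qed.

Lemma card_first_col : #|first_row col_of| = size la.
Proof.
apply/eqP; rewrite eqn_leq; apply/andP; split.
  apply: (@card_le_inj _ row_of) => [i j|i]; rewrite !inE; last by rewrite row_bound.
  by move=> /eqP ci /eqP cj rij; apply: (proj1 partition_young_tableau); rewrite ?ci ?cj.
apply: (@card_ge_surj _ row_of) => a lta.
have [|i ri ci] := @cell_exists a 0; last by exists i; rewrite // inE ci.
by rewrite lt0n; apply: contraNneq la_neq0 => <-; rewrite mem_nth.
Qed.

Lemma head_conj_partition : head 0%N (conj_partition la) = size la.
Proof.
move: la_neq0; rewrite /conj_partition; case: (la) => //= m l.
rewrite inE negb_or => /andP[]; case: m => // m _ l0 /=; rewrite add1n; congr _.+1.
by apply/eqP; rewrite -all_count; apply/allP=> x lx; rewrite /= lt0n; apply: contraNneq l0 => <-.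
Qed.

Lemma level_first_row : level la = minn #|~: first_row row_of| #|~: first_row col_of|.
Proof.
rewrite (cardsCs (~: first_row row_of)) (cardsCs (~: first_row col_of)) !setCK card_ord.
by rewrite /level head_conj_partition sum_la card_first_row card_first_col.
Qed.

Lemma chi_young_repr : chi n la = cfRepr (young_repr row_of col_of false).
Proof.
apply/cfRepr_sim/mx_rsim_iso/eqmx_iso.
have -> : young_symmetrizer n la =
    (#|fiber_stab col_of|%:R * #|fiber_stab row_of|%:R) *: young_vec row_of col_of false.
  rewrite /young_vec young_projE linearZ scalerA -invfM mulfV; last first.
    by rewrite mulf_neq0 // pnatr_eq0 -lt0n cardG_gt0.
  rewrite scale1r exchange_big; congr gring_row; apply: eq_bigr => p _.
  by apply: eq_bigr => q _; rewrite /twist mulr1.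
set k := _ * _; have nzk : k != 0 by rewrite mulf_neq0 // pnatr_eq0 -lt0n cardG_gt0.
apply/eqmxP/andP; split; apply: cyclic_mx_sub; rewrite ?cyclic_mx_module //.
  exact/scalemx_sub/cyclic_mx_id.
rewrite -[X in (X <= _)%MS]scale1r -(mulVf nzk) -scalerA.
exact/scalemx_sub/cyclic_mx_id.
Qed.

(** When the level comes from the first column, the transposed tableau and the
    other choice of signs are used. *)
Lemma chi_young_twist :
  exists (r c : 'I_n -> nat) s, [/\ young_tableau r c, chi n la = cfRepr (young_repr r c s)
    & #|~: first_row r| = level la].
Proof.
rewrite level_first_row; have tab := partition_young_tableau.
have [_ | _] := leqP #|~: first_row row_of| #|~: first_row col_of|.
  by exists row_of, col_of, false; rewrite chi_young_repr.
exists col_of, row_of, true; rewrite chi_young_repr; split=> //.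
  exact: young_tableau_transpose.
exact: young_repr_transpose.
Qed.

End Partition.

Lemma chi_localized n la : is_partition_of n la ->
  exists N (rG : mx_representation algC [set: 'S_n] N) s (C : {set 'I_n}) k (U : 'M_(k, N)),
  [/\ mx_irreducible rG, chi n la = cfRepr rG, row_free U & localized rG s C U] /\
  [/\ #|~: C| = level la & (n ^ level la * k <= 2 ^ level la * level la ^ level la * N)%N].
Proof.
move=> /chi_young_twist[r [c [s [tab defchi lvl]]]].
exists _, (young_repr r c s), s, (first_row r), _, (local_rows r c s); split; last first.
  by have := local_rank_bound s tab lvl; rewrite card_ord.
split=> //; first exact: young_repr_irr.
  exact: local_rows_free.
exact: local_rows_localized.
Qed.

(** * Bounds on Kronecker coefficients and degrees *)

Section LocalizedCharacters.
Variable n : nat.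
Local Notation G := [set: 'S_n].

Lemma cfRepr_irr N (rG : mx_representation algC G N) :
  mx_irreducible rG -> cfRepr rG \in irr G.
Proof. by move=> irrG; apply/irr_reprP; exists (Representation rG). Qed.

Definition kron (f1 f2 f3 : 'CF(G)) : algC :=
  n`!%:R^-1 * \sum_(g : 'S_n) f1 g * f2 g * f3 g.

Lemma kron_cfdot f1 f2 f3 : kron f1 f2 f3 = '[f1 * f2, f3^*%CF].
Proof.
rewrite /kron cfdotE cardsT card_Sn; congr (_ * _); apply: eq_big => [g|g _].
  by rewrite inE.
by rewrite !cfunE conjCK.
Qed.

(** The conjugate of the third character occurs g times in the product of the
    first two, hence g times its multiplicity of twist s3 on Sym C3, at least k3,
    is at most that of the product, which the tensor rank bound controls. *)
Lemma kron_bound N1 (rG1 : mx_representation algC G N1) s1 (C1 : {set 'I_n}) k1 (U1 : 'M_(k1, N1))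
    N2 (rG2 : mx_representation algC G N2) s2 (C2 : {set 'I_n}) k2 (U2 : 'M_(k2, N2))
    N3 (rG3 : mx_representation algC G N3) s3 (C3 : {set 'I_n}) k3 (U3 : 'M_(k3, N3)) :
  localized rG1 s1 C1 U1 -> localized rG2 s2 C2 U2 -> localized rG3 s3 C3 U3 ->
  mx_irreducible rG3 -> row_free U3 ->
  kron (cfRepr rG1) (cfRepr rG2) (cfRepr rG3) * k3%:R
    <= (4 ^ (#|~: C1| + #|~: C2| + #|~: C3|) * (k1 * k2))%:R.
Proof.
move=> loc1 loc2 [fix3 _ _] irr3 free3.
(* E contains the complement of C3 and has room for two more complements, unless
   it is everything. *)
have [E [sE leE bigE]] : exists E : {set 'I_n}, [/\ ~: C3 \subset E,
    (#|E| <= #|~: C1| + #|~: C2| + #|~: C3|)%N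
    & (#|~: C1| + #|~: C2| <= #|E :&: C3|)%N || (E == [set: 'I_n])].
  have [le12 | gt12] := leqP (#|~: C1| + #|~: C2|) #|C3|.
    have : (0 < #|[set B : {set 'I_n} | B \subset C3 & #|B| == (#|~: C1| + #|~: C2|)%N]|)%N.
      by rewrite cards_draws bin_gt0.
    case/card_gt0P=> B; rewrite inE => /andP[sB /eqP cardB]; exists (B :|: ~: C3).
    split; first exact: subsetUr.
      by rewrite -cardB (leq_trans (leq_card_setU _ _)).
    by rewrite -cardB subset_leq_card // subsetI sB subsetUl.
  exists [set: 'I_n]; rewrite subsetT eqxx orbT; split=> //.
  by rewrite cardsT -(cardsC C3) leq_add2r ltnW.
have ge3 : k3%:R <= twisted_mean (Sym_group C3) s3 (cfRepr rG3).
  rewrite -{1}(eqP free3); apply: twisted_mean_ge_rank => h.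
  by rewrite inE; apply: fix3.
have ge3' : k3%:R <= twisted_mean (Sym_group C3) s3 (cfRepr rG3)^*%CF.
  by rewrite twisted_mean_conj twisted_mean_repr conjC_nat -twisted_mean_repr.
have char12 : cfRepr rG1 * cfRepr rG2 \is a character by rewrite rpredM ?cfRepr_char.
have irr3' : (cfRepr rG3)^*%CF \in irr G by rewrite cfAut_irr cfRepr_irr.
have nat_g : 0 <= '[cfRepr rG1 * cfRepr rG2, (cfRepr rG3)^*%CF].
  by rewrite natr_ge0 // Cnat_cfdot_char // irrWchar.
rewrite kron_cfdot; apply: le_trans (ler_wpM2l nat_g ge3') _.
apply: le_trans (twisted_mean_constt _ _ char12 irr3') _.
rewrite cfRepr_prod twisted_mean_repr ler_nat.
apply: leq_trans (localized_tensor_rank _ loc1 loc2 sE bigE) _.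
by rewrite leq_mul2r -expnMn leq_pexp2l ?leE ?orbT.
Qed.

(** The index of Sym C is the falling factorial. *)
Lemma irr_degree_fixed_bound N (rG : mx_representation algC G N) s (C : {set 'I_n})
    k (U : 'M_(k, N)) :
  mx_irreducible rG -> row_free U -> localized rG s C U ->
  (N * k <= n ^_ #|~: C|)%N.
Proof.
move=> irrG freeU [fixU _ _].
have ge : k%:R <= twisted_mean (Sym_group C) s (cfRepr rG).
  rewrite -{1}(eqP freeU); apply: twisted_mean_ge_rank => h.
  by rewrite inE; apply: fixU.
have := twisted_mean_irr_deg (Sym_group C) s (cfRepr_irr irrG).
rewrite cfRepr1 cardsT card_Sn /= card_Sym.
have -> : #|C| = (n - #|~: C|)%N by rewrite cardsCs card_ord.
have leCn : (#|~: C| <= n)%N by rewrite -[leqRHS]card_ord max_card.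
rewrite -(ffact_fact leCn) natrM mulfK ?pnatr_eq0 -?lt0n ?fact_gt0 // => le_deg.
by rewrite -(ler_nat algC) natrM; apply: le_trans (ler_wpM2l _ ge) le_deg; rewrite ler0n.
Qed.

End LocalizedCharacters.

Lemma ffact_le_expn n d : (n ^_ d <= n ^ d)%N.
Proof.
have -> : (n ^ d = \prod_(i < d) n)%N by rewrite prod_nat_const card_ord.
by rewrite ffact_prod; apply: leq_prod => i _; exact: leq_subr.
Qed.

Lemma bin_le_expn m k : ('C(m, k) <= 2 ^ m)%N.
Proof.
rewrite -[m in 'C(m, k)]card_ord -card_draws -[m in (2 ^ m)%N]card_ord -cardsT -card_powerset.
by apply: subset_leq_card; rewrite powersetT subsetT.
Qed.

(** The product of d + 1, ..., 2 d is at least d ^ d, and equals d! times a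
    binomial coefficient bounded by 4 ^ d. *)
Lemma expnn_le_fact d : (d ^ d <= 4 ^ d * d`!)%N.
Proof.
apply: (@leq_trans ('C(2 * d, d) * d`!)); last first.
  by rewrite leq_mul2r -(expnM 2 2) bin_le_expn orbT.
have -> : (d ^ d = \prod_(i < d) d)%N by rewrite prod_nat_const card_ord.
rewrite bin_ffact ffact_prod; apply: leq_prod => i _.
by rewrite mul2n -addnn -addnBA ?leq_addr // ltnW.
Qed.

(** Multiply N <= binomial(n, d) k and N k <= n^d: the unknown k cancels, which
    bounds the degree N by n^d / sqrt d! up to the level factor. *)
Lemma localized_degree_sqr n N (rG : mx_representation algC [set: 'S_n] N) s (C : {set 'I_n}) k
    (U : 'M_(k, N)) d :
  mx_irreducible rG -> row_free U -> localized rG s C U -> #|~: C| = d ->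
  ((d ^ d * N) ^ 2 <= 4 ^ d * d ^ d * (n ^ d) ^ 2)%N.
Proof.
move=> irrG freeU locU cardC.
have le1 := irr_degree_fixed_bound irrG freeU locU; rewrite cardC in le1.
have led : (d <= n)%N by rewrite -cardC -[leqRHS]card_ord max_card.
have := localized_degree_le locU.
have -> : #|C| = (n - d)%N by rewrite cardsCs cardC card_ord.
rewrite card_ord bin_sub // => le2.
have le3 : (N ^ 2 * d`! <= (n ^ d) ^ 2)%N.
  apply: (@leq_trans ((n ^_ d) * (n ^_ d))); last by rewrite -mulnn leq_mul ?ffact_le_expn.
  rewrite -{1}bin_ffact -mulnn mulnAC (mulnC (N * _)%N).
  apply: (@leq_trans ('C(n, d) * k * d`! * N)).
    by rewrite -!mulnA (mulnC d`!) !mulnA leq_mul2r leq_mul2r le2 !orbT.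
  by rewrite -!mulnA (mulnCA k) !mulnA -mulnA leq_mul2l (mulnC k) le1 orbT.
have := expnn_le_fact d; move: le3.
move: (d ^ d)%N (4 ^ d)%N d`! (n ^ d)%N => a b f M le3 le4.
have le5 := leq_mul (leqnn (a * N ^ 2)) le4; have le6 := leq_mul (leqnn (a * b)) le3.
have -> : ((a * N) ^ 2 = a * N ^ 2 * a)%N by lia.
apply: leq_trans le5 _; have -> : (a * N ^ 2 * (b * f) = a * b * (N ^ 2 * f))%N by lia.
by have -> : (b * a * M ^ 2 = a * b * M ^ 2)%N by lia.
Qed.

Section NatBounds.
Variables (n d1 d2 d3 k1 k2 k3 N1 N2 N3 : nat).
Hypotheses (le12 : (d1 <= d2)%N) (le23 : (d2 <= d3)%N).

(** The product of the three bounds on m k_i gives the cube of m, and the k_i are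
    then replaced by degrees.  The constant is 2^21 = (4^3 2)^3, because
    d1 + d2 + d3 <= 3 d3. *)
Lemma cube_bound m :
  (0 < k1)%N -> (0 < k2)%N -> (0 < k3)%N ->
  (m * k3 <= 4 ^ (d1 + d2 + d3) * (k1 * k2))%N ->
  (m * k2 <= 4 ^ (d1 + d2 + d3) * (k1 * k3))%N ->
  (m * k1 <= 4 ^ (d1 + d2 + d3) * (k2 * k3))%N ->
  (n ^ d1 * k1 <= 2 ^ d1 * d1 ^ d1 * N1)%N ->
  (n ^ d2 * k2 <= 2 ^ d2 * d2 ^ d2 * N2)%N ->
  (n ^ d3 * k3 <= 2 ^ d3 * d3 ^ d3 * N3)%N ->
  (m ^ 3 * n ^ (d1 + d2 + d3)
     <= (2 ^ 21) ^ d3 * d1 ^ d1 * d2 ^ d2 * d3 ^ d3 * N1 * N2 * N3)%N.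
Proof.
move=> k1p k2p k3p m3 m2 m1 e1 e2 e3.
have cube : (m ^ 3 <= (4 ^ (d1 + d2 + d3)) ^ 3 * (k1 * k2 * k3))%N.
  rewrite -(leq_pmul2r (_ : 0 < k1 * k2 * k3)%N) ?muln_gt0 ?k1p ?k2p //.
  have := leq_mul (leq_mul m3 m2) m1; move: (4 ^ _)%N => b le.
  have -> : (m ^ 3 * (k1 * k2 * k3) = m * k3 * (m * k2) * (m * k1))%N by lia.
  apply: leq_trans le _; apply: eq_leq; lia.
have exps : ((4 ^ (d1 + d2 + d3)) ^ 3 * 2 ^ (d1 + d2 + d3) <= (2 ^ 21) ^ d3)%N.
  have e7 : (4 ^ 3 * 2 = 2 ^ 7)%N by [].
  by rewrite expnAC -expnMn e7 -!expnM leq_pexp2l //; lia.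
have prod := leq_mul exps (leq_mul (leq_mul e1 e2) e3).
move: cube prod; rewrite !expnD.
move: ((2 ^ 21) ^ d3)%N ((4 ^ d1 * 4 ^ d2 * 4 ^ d3) ^ 3)%N => B b.
have := (expn_gt0 2 d1, expn_gt0 2 d2, expn_gt0 2 d3); move: (m ^ 3)%N => M.
move: (2 ^ d1)%N (2 ^ d2)%N (2 ^ d3)%N (d1 ^ d1)%N (d2 ^ d2)%N (d3 ^ d3)%N.
move: (n ^ d1)%N (n ^ d2)%N (n ^ d3)%N => x1 x2 x3 t1 t2 t3 y1 y2 y3 [[p1 p2] p3] cube prod.
rewrite -(leq_pmul2r (_ : 0 < t1 * t2 * t3)%N); last by rewrite !muln_gt0 p1 p2 p3.
apply: leq_trans (leq_mul (leq_mul cube (leqnn _)) (leqnn _)) _.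
have -> : (b * (k1 * k2 * k3) * (x1 * x2 * x3) * (t1 * t2 * t3) =
           b * (t1 * t2 * t3) * (x1 * k1 * (x2 * k2) * (x3 * k3)))%N by lia.
apply: leq_trans prod _; apply: eq_leq; lia.
Qed.

End NatBounds.

(** * Extraction of roots *)

Lemma kron_nat n (f1 f2 f3 : 'CF([set: 'S_n])) :
  f1 \is a character -> f2 \is a character -> f3 \is a character ->
  kron f1 f2 f3 \is a Num.nat.
Proof.
move=> c1 c2 c3; rewrite kron_cfdot Cnat_cfdot_char ?rpredM //.
by rewrite cfConjC_char.
Qed.

Lemma kron_swap23 n (f1 f2 f3 : 'CF([set: 'S_n])) : kron f1 f2 f3 = kron f1 f3 f2.
Proof. by congr (_ * _); apply: eq_bigr => g _; rewrite mulrAC. Qed.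

Lemma kron_rotate n (f1 f2 f3 : 'CF([set: 'S_n])) : kron f1 f2 f3 = kron f2 f3 f1.
Proof. by congr (_ * _); apply: eq_bigr => g _; rewrite -mulrA mulrC. Qed.

Lemma localized_rank_gt0 n N (rG : mx_representation algC [set: 'S_n] N) s
    (C : {set 'I_n}) k (U : 'M_(k, N)) :
  mx_irreducible rG -> localized rG s C U -> (0 < k)%N.
Proof.
move=> /mx_irrP[N0 _] /localized_degree_le; case: k U => // U.
by rewrite muln0 leqNgt N0.
Qed.

Section RootBounds.
Variables (d1 d2 d3 n N1 N2 N3 : nat).
Hypotheses (le12 : (d1 <= d2)%N) (le23 : (d2 <= d3)%N) (n0 : (0 < n)%N).
Let X : algC := (2%:R ^+ 21) ^+ d3 * d1%:R ^+ d1 * d2%:R ^+ d2 * d3%:R ^+ d3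
                      / n%:R ^+ (d1 + d2 + d3) * N1%:R * N2%:R * N3%:R.

Let X_ge0 : 0 <= X.
Proof. by rewrite /X !mulr_ge0 ?invr_ge0 ?exprn_ge0 ?ler0n. Qed.

Lemma le_root3 (m : nat) :
  (m ^ 3 * n ^ (d1 + d2 + d3)
     <= (2 ^ 21) ^ d3 * d1 ^ d1 * d2 ^ d2 * d3 ^ d3 * N1 * N2 * N3)%N ->
  m%:R <= 3.-root X.
Proof.
move=> le_m; rewrite -[m%:R](@exprCK _ 3) ?ler0n // ler_rootC ?qualifE /= ?exprn_ge0 ?ler0n //.
have -> : X = (2%:R ^+ 21) ^+ d3 * d1%:R ^+ d1 * d2%:R ^+ d2 * d3%:R ^+ d3
    * N1%:R * N2%:R * N3%:R / n%:R ^+ (d1 + d2 + d3).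
  rewrite /X; set E := _^-1; set P := _ * d3%:R ^+ d3; rewrite -!(mulrAC _ E) //.
rewrite ler_pdivlMr ?exprn_gt0 ?ltr0n // -!natrX -!natrM ler_nat; exact: le_m.
Qed.

(** Squaring turns the degree bounds into integral powers.  The constant 2^8 is
    chosen so that its sixth power 2^48 is (2^21)^2 times 4^3. *)
Lemma root3_le :
  ((d1 ^ d1 * N1) ^ 2 <= 4 ^ d1 * d1 ^ d1 * (n ^ d1) ^ 2)%N ->
  ((d2 ^ d2 * N2) ^ 2 <= 4 ^ d2 * d2 ^ d2 * (n ^ d2) ^ 2)%N ->
  ((d3 ^ d3 * N3) ^ 2 <= 4 ^ d3 * d3 ^ d3 * (n ^ d3) ^ 2)%N ->
  3.-root X <= (2%:R ^+ 8) ^+ d3 * 6.-root (d1%:R ^+ d1) * 6.-root (d2%:R ^+ d2)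
             * 6.-root (d3%:R ^+ d3).
Proof.
move=> e1 e2 e3; set Y := (Y in _ <= Y).
have Y_ge0 : 0 <= Y.
  by rewrite /Y !mulr_ge0 ?rootC_ge0 ?exprn_ge0 ?ler0n.
rewrite -[Y](@exprCK _ 3) // ler_rootC ?qualifE /= ?exprn_ge0 //.
rewrite -(ler_pXn2r (n := 2)) ?nnegrE ?exprn_ge0 // -exprM.
have -> : Y ^+ (3 * 2) = ((2%:R ^+ 8) ^+ d3) ^+ 6 * d1%:R ^+ d1 * d2%:R ^+ d2 * d3%:R ^+ d3.
  by rewrite /Y !exprMn !(@rootCK _ 6).
set A := d1%:R ^+ d1 : algC; set B := d2%:R ^+ d2 : algC; set D := d3%:R ^+ d3 : algC.
have step d N : ((d ^ d * N) ^ 2 <= 4 ^ d * d ^ d * (n ^ d) ^ 2)%N ->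
    (d%:R ^+ d * N%:R / n%:R ^+ d) ^+ 2 <= 4%:R ^+ d * d%:R ^+ d :> algC.
  move=> le; rewrite exprMn exprVn ler_pdivrMr ?exprn_gt0 ?ltr0n //.
  by rewrite -!natrX -!natrM -!natrX ler_nat.
pose Q d N : algC := d%:R ^+ d * N%:R / n%:R ^+ d.
have defX : X = (2%:R ^+ 21) ^+ d3 * (Q d1 N1 * Q d2 N2 * Q d3 N3).
  rewrite /X /Q !exprD !invfM -/A -/B -/D.
  move: ((2%:R ^+ 21) ^+ d3) A B D (n%:R ^+ d1)^-1 (n%:R ^+ d2)^-1 (n%:R ^+ d3)^-1.
  by move=> ? ? ? ? ? ? ?; ring.
have Q2 d N : 0 <= Q d N ^+ 2.
  by rewrite exprn_ge0 // /Q mulr_ge0 ?invr_ge0 ?mulr_ge0 ?exprn_ge0 ?ler0n.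
have le_Q : (Q d1 N1 * Q d2 N2 * Q d3 N3) ^+ 2
            <= 4%:R ^+ d1 * A * (4%:R ^+ d2 * B) * (4%:R ^+ d3 * D).
  rewrite (exprMn _ (_ * _) (Q d3 N3)) (exprMn _ (Q d1 N1) (Q d2 N2)).
  apply: ler_pM; [exact: mulr_ge0 | exact: Q2 | | exact: step].
  by apply: ler_pM; rewrite ?Q2 //; apply: step.
rewrite defX exprMn.
apply: le_trans (ler_wpM2l _ le_Q) _; first by rewrite !exprn_ge0 ?ler0n.
have -> : ((2%:R ^+ 21) ^+ d3) ^+ 2 * (4%:R ^+ d1 * A * (4%:R ^+ d2 * B) * (4%:R ^+ d3 * D))
   = ((2%:R ^+ 21) ^+ d3) ^+ 2 * 4%:R ^+ (d1 + d2 + d3) * (A * B * D).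
  rewrite !exprD; move: (((2%:R ^+ 21) ^+ d3) ^+ 2) => K.
  by move: (4%:R ^+ d1) (4%:R ^+ d2) (4%:R ^+ d3) => ? ? ?; ring.
have -> : ((2%:R ^+ 8) ^+ d3) ^+ 6 * A * B * D = ((2%:R ^+ 8) ^+ d3) ^+ 6 * (A * B * D).
  by rewrite !mulrA.
apply: ler_wpM2r; first by rewrite !mulr_ge0 ?exprn_ge0 ?ler0n.
have -> : 4%:R = 2%:R ^+ 2 :> algC by rewrite -natrX.
by rewrite -!exprM -exprD ler_weXn2l ?ler1n //; lia.
Qed.

End RootBounds.

Theorem corollary2p2 :
  exists C Cbar : algC, [/\ 0 < C, 0 < Cbar &
    forall (d1 d2 d3 : nat), (0 < d1)%N -> (d1 <= d2)%N -> (d2 <= d3)%N ->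
    forall (n : nat) (la mu nu : seq nat),
      is_partition_of n la -> is_partition_of n mu -> is_partition_of n nu ->
      level la = d1 -> level mu = d2 -> level nu = d3 ->
      kronecker n la mu nu
        <= 3.-root (C ^+ d3 * d1%:R ^+ d1 * d2%:R ^+ d2 * d3%:R ^+ d3
                      / n%:R ^+ (d1 + d2 + d3)
                    * chi n la 1%g * chi n mu 1%g * chi n nu 1%g)
        <= Cbar ^+ d3 * 6.-root (d1%:R ^+ d1) * 6.-root (d2%:R ^+ d2)
             * 6.-root (d3%:R ^+ d3)].
Proof.
exists (2%:R ^+ 21), (2%:R ^+ 8); split; rewrite ?exprn_gt0 ?ltr0n //.
move=> d1 d2 d3 d1_gt0 le12 le23 n la mu nu la_n mu_n nu_n lvl1 lvl2 lvl3.
have n_gt0 : (0 < n)%N.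
  have [n0|//] := posnP n; move: d1_gt0; rewrite -lvl1 /level.
  by case/and3P: la_n => _ _ /eqP->; rewrite n0 sub0n min0n.
have [N1 [rG1 [s1 [C1 [k1 [U1 [[irr1 def1 free1 loc1] []]]]]]]] := chi_localized la_n.
have [N2 [rG2 [s2 [C2 [k2 [U2 [[irr2 def2 free2 loc2] []]]]]]]] := chi_localized mu_n.
have [N3 [rG3 [s3 [C3 [k3 [U3 [[irr3 def3 free3 loc3] []]]]]]]] := chi_localized nu_n.
rewrite lvl1 lvl2 lvl3 => card3 deg3 card2 deg2 card1 deg1.
have -> : kronecker n la mu nu = kron (chi n la) (chi n mu) (chi n nu) by [].
rewrite def1 def2 def3 !cfRepr1.
have [m def_g] := natrP (kron_nat (cfRepr_char rG1) (cfRepr_char rG2) (cfRepr_char rG3)).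
have b3 := kron_bound loc1 loc2 loc3 irr3 free3.
have b2 := kron_bound loc1 loc3 loc2 irr2 free2.
have b1 := kron_bound loc2 loc3 loc1 irr1 free1.
rewrite -kron_swap23 in b2; rewrite -kron_rotate in b1.
rewrite def_g card1 card2 card3 -natrM ler_nat in b1.
rewrite def_g card1 card2 card3 -natrM ler_nat in b2.
rewrite def_g card1 card2 card3 -natrM ler_nat in b3; rewrite def_g.
rewrite addnAC in b2; rewrite addnC addnA in b1.
apply/andP; split.
  apply: le_root3 => //; apply: (@cube_bound n d1 d2 d3 k1 k2 k3) => //.
  - exact: localized_rank_gt0 irr1 loc1.
  - exact: localized_rank_gt0 irr2 loc2.
  - exact: localized_rank_gt0 irr3 loc3.
apply: root3_le => //.
- exact: localized_degree_sqr irr1 free1 loc1 card1.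
- exact: localized_degree_sqr irr2 free2 loc2 card2.
- exact: localized_degree_sqr irr3 free3 loc3 card3.
Qed.
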